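(* Let $T$ be a polygonal trajectory with $n$ vertices and $s>0$ a fixed side length. After $O(n)$ preprocessing, time-windowed hotspot queries can be answered with time complexity $O(\log^2 n)$: each query is given by two times $x<y$ (which need not coincide with time-stamps of vertices of $T$), and the algorithm returns an axis-parallel square of side length $s$ whose weight with respect to $T_{xy}$ is at least half of the weight of a hotspot of $T_{xy}$.
   Context: A polygonal trajectory $T$ is given by a sequence of vertices; each vertex has a location in $\mathbb{R}^2$ and a time-stamp, with time-stamps strictly increasing; the position $T(t)$ at intermediate times is obtained by linear interpolation between consecutive vertices. For times $a<b$ within the time span of $T$, $T_{ab}$ denotes the sub-trajectory from time $a$ to time $b$. All squares are axis-parallel with fixed side length $s$. The weight of a square $r$ with respect to a trajectory $T'$ is the maximum duration of a contiguous sub-trajectory of $T'$ contained in $r$. A hotspot of $T'$ is a square of maximum weight with respect to $T'$. *)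

(* Defs.v *)
From Stdlib Require Import Reals ZArith List.
From Coquelicot Require Import Coquelicot.
Open Scope R_scope.

Record vertex := Vertex { vx : R; vy : R; vt : R }.

Fixpoint times_increasing (V : list vertex) : Prop :=
  match V with
  | v :: ((w :: _) as rest) => vt v < vt w /\ times_increasing rest
  | _ => True
  end.

Definition first_time (V : list vertex) : R :=
  match V with v :: _ => vt v | nil => 0 end.
Definition last_time (V : list vertex) : R := vt (last V (Vertex 0 0 0)).

(* Position T(t), by linear interpolation between consecutive vertices
   (meaningful for t in the time span [first_time V, last_time V]). *)
Fixpoint pos (V : list vertex) (t : R) : R * R :=
  match V with
  | v :: ((w :: _) as rest) =>
      if Rle_dec t (vt w) then
        let lam := (t - vt v) / (vt w - vt v) in
        (vx v + lam * (vx w - vx v), vy v + lam * (vy w - vy v))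
      else pos rest t
  | v :: nil => (vx v, vy v)
  | nil => (0, 0)
  end.

Definition in_square (s : R) (c : R * R) (p : R * R) : Prop :=
  fst c <= fst p <= fst c + s /\ snd c <= snd p <= snd c + s.

Definition sub_contained (s : R) (c : R * R) (V : list vertex) (a b : R) : Prop :=
  forall t, a <= t <= b -> in_square s c (pos V t).

(* Weight of the square (corner c, side s) w.r.t. T_xy: the maximum duration
   of a contiguous sub-trajectory T_ab (x <= a <= b <= y) of T_xy contained
   in the square (0 if there is none).  The maximum is written as a supremum
   (it is attained). *)
Definition weight (s : R) (V : list vertex) (x y : R) (c : R * R) : R :=
  real (Lub_Rbar (fun d => d = 0 \/
          exists a b, x <= a /\ a <= b /\ b <= y /\ d = b - a /\
                      sub_contained s c V a b)).

(* The weight of a hotspot of T_xy: the maximum weight over all squares of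
   side s (written as a supremum; it is attained). *)
Definition hotspot_weight (s : R) (V : list vertex) (x y : R) : R :=
  real (Lub_Rbar (fun w => exists c : R * R, w = weight s V x y c)).

(* Two unbounded memories: real cells (nat -> R) and integer cells
   (nat -> Z).  A program is a finite list of instructions; each executed
   instruction costs one unit of time.  There is no real -> integer
   conversion (no floor), and integers support only +, -, halving and
   comparison, to rule out the usual word-packing / floor cheats. *)
Inductive instr :=
| RConst (k : nat) (z : Z)
| RAdd (k i j : nat)
| RSub (k i j : nat)
| RMul (k i j : nat)
| RDiv (k i j : nat)
| IToR (k a : nat)
| RLoad (k a : nat)
| RStore (a k : nat)
| RJmpLt (i j l : nat)
| IConst (k : nat) (z : Z)
| IAdd (k i j : nat)
| ISub (k i j : nat)
| IHalf (k i : nat)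
| ILoad (k a : nat)
| IStore (a k : nat)
| IJmpLt (i j l : nat)
| Jmp (l : nat)
| Halt.

Definition program := list instr.

Record state := State { pc : nat; rmem : nat -> R; imem : nat -> Z }.

Definition upd {A} (f : nat -> A) (k : nat) (v : A) : nat -> A :=
  fun j => if Nat.eqb j k then v else f j.

Definition addr (st : state) (a : nat) : nat := Z.to_nat (imem st a).

Definition setR (st : state) (k : nat) (v : R) : state :=
  State (S (pc st)) (upd (rmem st) k v) (imem st).
Definition setI (st : state) (k : nat) (v : Z) : state :=
  State (S (pc st)) (rmem st) (upd (imem st) k v).
Definition jump (st : state) (b : bool) (l : nat) : state :=
  State (if b then l else S (pc st)) (rmem st) (imem st).

Definition step (P : program) (st : state) : option state :=
  let r := rmem st in let m := imem st in
  match nth_error P (pc st) with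
  | None | Some Halt => None
  | Some (RConst k z) => Some (setR st k (IZR z))
  | Some (RAdd k i j) => Some (setR st k (r i + r j))
  | Some (RSub k i j) => Some (setR st k (r i - r j))
  | Some (RMul k i j) => Some (setR st k (r i * r j))
  | Some (RDiv k i j) => Some (setR st k (r i / r j))
  | Some (IToR k a) => Some (setR st k (IZR (m a)))
  | Some (RLoad k a) => Some (setR st k (r (addr st a)))
  | Some (RStore a k) => Some (setR st (addr st a) (r k))
  | Some (RJmpLt i j l) =>
      Some (jump st (if Rlt_dec (r i) (r j) then true else false) l)
  | Some (IConst k z) => Some (setI st k z)
  | Some (IAdd k i j) => Some (setI st k (m i + m j)%Z)
  | Some (ISub k i j) => Some (setI st k (m i - m j)%Z)
  | Some (IHalf k i) => Some (setI st k (Z.div (m i) 2))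
  | Some (ILoad k a) => Some (setI st k (m (addr st a)))
  | Some (IStore a k) => Some (setI st (addr st a) (m k))
  | Some (IJmpLt i j l) => Some (jump st (Z.ltb (m i) (m j)) l)
  | Some (Jmp l) => Some (jump st true l)
  end.

Inductive exec (P : program) : nat -> state -> state -> Prop :=
| exec_halt st : step P st = None -> exec P 0 st st
| exec_step st st' k st'' :
    step P st = Some st' -> exec P k st' st'' -> exec P (S k) st st''.

(* Input encoding for preprocessing: R[2] = s, and vertex i is stored in
   R[3+3i], R[4+3i], R[5+3i] as (x_i, y_i, t_i); I[0] = n; all other
   cells are 0; pc = 0. *)
Definition vertex_comp (v : vertex) (r : nat) : R :=
  match r with 0%nat => vx v | 1%nat => vy v | _ => vt v end.

Definition init_state (s : R) (V : list vertex) : state :=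
  State 0
    (fun j => if Nat.eqb j 2 then s
              else if Nat.leb 3 j then
                match nth_error V ((j - 3) / 3) with
                | Some v => vertex_comp v ((j - 3) mod 3)
                | None => 0
                end
              else 0)
    (fun j => if Nat.eqb j 0 then Z.of_nat (length V) else 0%Z).

(* Query input: starting from the memory M left by preprocessing, write
   x into R[0] and y into R[1], and start at pc = 0.  The answer square is
   read off as its lower-left corner (R[0], R[1]) when the query halts. *)
Definition query_state (M : state) (x y : R) : state :=
  State 0 (upd (upd (rmem M) 0 x) 1 y) (imem M).

Definition output_corner (M : state) : R * R := (rmem M 0, rmem M 1).

(* Main.v *)
Require Import Defs.
From Stdlib Require Import Reals ZArith List Lia Lra.
From Coquelicot Require Import Coquelicot.
Import ListNotations.
Local Open Scope nat_scope.

(* Cut the trajectory greedily into blocks: from the current time g, let R(g) be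
   the last time such that the sub-trajectory from g to R(g) fits into a square,
   and let the block end at R(g), or at the next vertex if that comes later.
   There are O(n) blocks, a single scan with a running bounding box finds them,
   and within a block a sub-trajectory fits iff it is not longer than R(g) - g:
   blocks that pass a vertex fit entirely, the others lie on one edge, along
   which the square can be translated.  As nothing that fits leads from the start
   of a block beyond its end, every fitting sub-trajectory is covered by two
   consecutive blocks, so the best block clipped to the query window is a
   2-approximation.  Only the blocks containing x and y get clipped; the best of
   those in between is found in a tournament tree in O(log n) steps. *)

(** Extending a block to the next vertex is what bounds the number of blocks: on one long edge,
    blocks that ended where the square is left could be arbitrarily many. With the extension, every
    block closed by the scan has a vertex after its start, at the latest at its end. The extension
    costs nothing, because the velocity on an edge is constant: stretches of equal duration are
    translates of each other, so one duration and one velocity describe all fitting stretches of the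
    block. A block strictly inside the query window has the same value for every such window, which
    is why the tree can be built in advance. The bounds concern a concrete machine, and this shapes
    the other half of the proof. The algorithms are written as structured commands with a semantics
    that counts instructions, a compiler is verified once with exact counts, and loops are bounded
    by potentials. Since the input occupies the cells meant for variables, hand-written code moves
    it first. The query time obtained is O(log n), within the claimed O(log^2 n). *)

(** * Structured programs and their compilation *)

(** Unlike [exec], this relation does not require the last state to be halted, so runs of
    consecutive pieces of code can be composed. *)
Inductive steps (P : program) : nat -> state -> state -> Prop :=
| steps_refl st : steps P 0 st st
| steps_cons st st' k st'' :
    step P st = Some st' -> steps P k st' st'' -> steps P (S k) st st''.

Lemma steps_trans P k1 k2 a b c :
  steps P k1 a b -> steps P k2 b c -> steps P (k1 + k2) a c.
Proof.
  induction 1 as [|st st' k st'' Hs _ IH]; intros H; [exact H|].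
  exact (steps_cons _ _ _ _ _ Hs (IH H)).
Qed.

Lemma steps_one P a b : step P a = Some b -> steps P 1 a b.
Proof. intros H. exact (steps_cons _ _ _ _ _ H (steps_refl _ _)). Qed.

Lemma steps_exec P k a b :
  steps P k a b -> step P b = None -> exec P k a b.
Proof.
  induction 1 as [|st st' k st'' Hs _ IH]; intros H.
  - now constructor.
  - exact (exec_step _ _ _ _ _ Hs (IH H)).
Qed.

Definition code_at (P : program) (o : nat) (l : list instr) : Prop :=
  exists pre post, P = pre ++ l ++ post /\ length pre = o.

Lemma code_at_app P o l1 l2 :
  code_at P o (l1 ++ l2) ->
  code_at P o l1 /\ code_at P (o + length l1) l2.
Proof.
  intros (pre & post & -> & Hl). split.
  - exists pre, (l2 ++ post). now rewrite <- app_assoc.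
  - exists (pre ++ l1), post. rewrite length_app, Hl.
    now rewrite <- !app_assoc.
Qed.

Lemma code_at_cons P o i l :
  code_at P o (i :: l) -> nth_error P o = Some i /\ code_at P (S o) l.
Proof.
  intros (pre & post & -> & <-). split.
  - rewrite nth_error_app2 by lia. now rewrite Nat.sub_diag.
  - exists (pre ++ [i]), post. rewrite length_app, <- app_assoc. cbn.
    split; [reflexivity | lia].
Qed.

Definition rimem : Type := (nat -> R) * (nat -> Z).

Definition exec1 (i : instr) (q : rimem) : rimem :=
  let (r, m) := q in
  match i with
  | RConst k z => (upd r k (IZR z), m)
  | RAdd k i j => (upd r k (r i + r j)%R, m)
  | RSub k i j => (upd r k (r i - r j)%R, m)
  | RMul k i j => (upd r k (r i * r j)%R, m)
  | RDiv k i j => (upd r k (r i / r j)%R, m)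
  | IToR k a => (upd r k (IZR (m a)), m)
  | RLoad k a => (upd r k (r (Z.to_nat (m a))), m)
  | RStore a k => (upd r (Z.to_nat (m a)) (r k), m)
  | IConst k z => (r, upd m k z)
  | IAdd k i j => (r, upd m k (m i + m j)%Z)
  | ISub k i j => (r, upd m k (m i - m j)%Z)
  | IHalf k i => (r, upd m k (Z.div (m i) 2))
  | ILoad k a => (r, upd m k (m (Z.to_nat (m a))))
  | IStore a k => (r, upd m (Z.to_nat (m a)) (m k))
  | _ => q
  end.

Definition straight (i : instr) : bool :=
  match i with
  | RJmpLt _ _ _ | IJmpLt _ _ _ | Jmp _ | Halt => false
  | _ => true
  end.

Definition runs (l : list instr) (q : rimem) : rimem :=
  fold_left (fun q i => exec1 i q) l q.

Definition at_pc (o : nat) (q : rimem) : state := State o (fst q) (snd q).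

Lemma step_straight P o i q :
  nth_error P o = Some i -> straight i = true ->
  step P (at_pc o q) = Some (at_pc (S o) (exec1 i q)).
Proof.
  destruct q as [r m]. intros H Hs. unfold step, at_pc; cbn [pc rmem imem fst snd].
  rewrite H. destruct i; cbn in Hs; try discriminate; reflexivity.
Qed.

Lemma steps_straight l : forall P o q,
  code_at P o l -> forallb straight l = true ->
  steps P (length l) (at_pc o q) (at_pc (o + length l) (runs l q)).
Proof.
  induction l as [|i l IH]; intros P o q Hc Hs.
  - cbn. rewrite Nat.add_0_r. constructor.
  - cbn in Hs. apply andb_prop in Hs as [Hi Hl].
    apply code_at_cons in Hc as [Hn Hc].
    eapply steps_cons; [apply step_straight; eassumption|].
    cbn [length]. rewrite Nat.add_succ_r, <- Nat.add_succ_l.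
    exact (IH P (S o) (exec1 i q) Hc Hl).
Qed.

Lemma runs_app l1 l2 q : runs (l1 ++ l2) q = runs l2 (runs l1 q).
Proof. apply fold_left_app. Qed.

(* Structured programs act on 32 real and 32 integer variables and on
   arrays with 16 fields each: element [i] of field [f] lives in cell
   [64 + 16 i + f].  Cells 32..63 hold intermediate values of expressions. *)

Inductive iexp :=
| ICst (z : Z) | IVar (k : nat) | IPlus (a b : iexp) | IMinus (a b : iexp)
| IHlf (a : iexp) | IArr (f : nat) (a : iexp).

Inductive rop := OAdd | OSub | OMul | ODiv.

Inductive rexp :=
| RCst (z : Z) | RVar (k : nat) | ROp (o : rop) (a b : rexp)
| RArr (f : nat) (a : iexp).

Record mem := Mem {
  rg : nat -> R; ig : nat -> Z;
  ra : nat -> nat -> R; ia : nat -> nat -> Z }.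

Definition upd2 {A} (g : nat -> nat -> A) (f i : nat) (v : A) :
  nat -> nat -> A :=
  fun f' i' => if andb (Nat.eqb f' f) (Nat.eqb i' i) then v else g f' i'.

Fixpoint ieval (e : iexp) (M : mem) : Z :=
  match e with
  | ICst z => z
  | IVar k => ig M k
  | IPlus a b => ieval a M + ieval b M
  | IMinus a b => ieval a M - ieval b M
  | IHlf a => Z.div (ieval a M) 2
  | IArr f a => ia M f (Z.to_nat (ieval a M))
  end%Z.

Definition rop_fun (o : rop) : R -> R -> R :=
  match o with OAdd => Rplus | OSub => Rminus | OMul => Rmult | ODiv => Rdiv end.

Fixpoint reval (e : rexp) (M : mem) : R :=
  match e with
  | RCst z => IZR z
  | RVar k => rg M k
  | ROp o a b => rop_fun o (reval a M) (reval b M)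
  | RArr f a => ra M f (Z.to_nat (ieval a M))
  end.

(* Negative array indices would alias other cells. *)
Fixpoint isafe (e : iexp) (M : mem) : Prop :=
  match e with
  | ICst _ | IVar _ => True
  | IPlus a b | IMinus a b => isafe a M /\ isafe b M
  | IHlf a => isafe a M
  | IArr f a => isafe a M /\ (0 <= ieval a M)%Z
  end.

Fixpoint rsafe (e : rexp) (M : mem) : Prop :=
  match e with
  | RCst _ | RVar _ => True
  | ROp _ a b => rsafe a M /\ rsafe b M
  | RArr f a => isafe a M /\ (0 <= ieval a M)%Z
  end.

(** Bounds the scratch space: an expression evaluated into cell [t] writes only to cells from [t] to
    63, so deep nesting cannot run into the arrays. *)
Fixpoint iwf (e : iexp) (t : nat) : bool :=
  match e with
  | ICst _ => Nat.ltb t 64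
  | IVar k => Nat.ltb k 32 && Nat.ltb t 64
  | IPlus a b | IMinus a b => iwf a t && iwf b (S t)
  | IHlf a => iwf a t
  | IArr f a => Nat.ltb f 16 && iwf a t && Nat.ltb (S t) 64
  end.

Fixpoint rwf (e : rexp) (t : nat) : bool :=
  match e with
  | RCst _ => Nat.ltb t 64
  | RVar k => Nat.ltb k 32 && Nat.ltb t 64
  | ROp _ a b => rwf a t && rwf b (S t)
  | RArr f a => Nat.ltb f 16 && iwf a 32 && Nat.ltb t 64
  end.

(** Integers cannot be multiplied; four doublings give the stride 16 of the array layout. *)
Definition cell_addr (f t : nat) : list instr :=
  [IAdd t t t; IAdd t t t; IAdd t t t; IAdd t t t;
   IConst (S t) (64 + Z.of_nat f); IAdd t t (S t)].

(** A variable is copied by adding it to zero, as the machine has no move instruction. *)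
Fixpoint icode (e : iexp) (t : nat) : list instr :=
  match e with
  | ICst z => [IConst t z]
  | IVar k => [IConst t 0; IAdd t k t]
  | IPlus a b => icode a t ++ icode b (S t) ++ [IAdd t t (S t)]
  | IMinus a b => icode a t ++ icode b (S t) ++ [ISub t t (S t)]
  | IHlf a => icode a t ++ [IHalf t t]
  | IArr f a => icode a t ++ cell_addr f t ++ [ILoad t t]
  end.

Definition rop_instr (o : rop) : nat -> nat -> nat -> instr :=
  match o with OAdd => RAdd | OSub => RSub | OMul => RMul | ODiv => RDiv end.

(** Array indices are computed in the integer cells from 32 on, whatever [t] is: no integer
    intermediate value is alive while a real expression is evaluated. *)
Fixpoint rcode (e : rexp) (t : nat) : list instr :=
  match e with
  | RCst z => [RConst t z]
  | RVar k => [RConst t 0; RAdd t k t]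
  | ROp o a b => rcode a t ++ rcode b (S t) ++ [rop_instr o t t (S t)]
  | RArr f a => icode a 32 ++ cell_addr f 32 ++ [RLoad t 32]
  end.

(** Cells 32 to 63 are left unconstrained, so leftover intermediate values never matter. *)
Definition agree {A} (reg : nat -> A) (arr : nat -> nat -> A) (c : nat -> A) :=
  (forall k, (k < 32)%nat -> c k = reg k) /\
  (forall f i, (f < 16)%nat -> c (64 + 16 * i + f)%nat = arr f i).

Definition agreeM (M : mem) (q : rimem) : Prop :=
  agree (rg M) (ra M) (fst q) /\ agree (ig M) (ia M) (snd q).

Lemma agree_frame {A} (reg : nat -> A) arr c c' :
  agree reg arr c ->
  (forall k, (k < 32 \/ 64 <= k)%nat -> c' k = c k) ->
  agree reg arr c'.
Proof.
  intros [H1 H2] H. split; intros; rewrite H by lia; auto.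
Qed.

Lemma upd_same {A} (g : nat -> A) k v : upd g k v k = v.
Proof. unfold upd. now rewrite Nat.eqb_refl. Qed.

Lemma upd_other {A} (g : nat -> A) k v j : j <> k -> upd g k v j = g j.
Proof. intros H. unfold upd. now apply Nat.eqb_neq in H as ->. Qed.

Ltac upd_simpl :=
  repeat (rewrite upd_same || (rewrite upd_other by lia)).

Lemma cell_addr_ok f t r m : (32 <= t)%nat -> (S t < 64)%nat ->
  exists m', runs (cell_addr f t) (r, m) = (r, m') /\
    m' t = (64 + 16 * m t + Z.of_nat f)%Z /\
    forall k, (k < t \/ 64 <= k)%nat -> m' k = m k.
Proof.
  intros Ht Ht'. unfold cell_addr, runs; cbn [fold_left exec1].
  eexists; split; [reflexivity|]. split.
  - upd_simpl. ring.
  - intros k Hk. upd_simpl. reflexivity.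
Qed.

Ltac bools H :=
  repeat match type of H with
  | andb _ _ = true => apply andb_prop in H; destruct H as [H ?]
  end; rewrite ?Nat.ltb_lt in *.

Lemma iwf_bound e : forall t, iwf e t = true -> (t < 64)%nat.
Proof.
  induction e; cbn -[Nat.ltb]; intros t H; bools H; auto; lia.
Qed.

Lemma icode_ok e : forall t M r m,
  agree (ig M) (ia M) m -> (32 <= t)%nat -> iwf e t = true -> isafe e M ->
  exists m', runs (icode e t) (r, m) = (r, m') /\ m' t = ieval e M /\
    forall k, (k < t \/ 64 <= k)%nat -> m' k = m k.
Proof.
  assert (BIN : forall a b op (g : Z -> Z -> Z),
    (forall q k i j, exec1 (op k i j) q =
       (fst q, upd (snd q) k (g (snd q i) (snd q j)))) ->
    forall t (M : mem) r m,
    (exists m', runs (icode a t) (r, m) = (r, m') /\ m' t = ieval a M /\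
      forall k, (k < t \/ 64 <= k)%nat -> m' k = m k) ->
    (forall m, agree (ig M) (ia M) m ->
      exists m', runs (icode b (S t)) (r, m) = (r, m') /\
      m' (S t) = ieval b M /\
      forall k, (k < S t \/ 64 <= k)%nat -> m' k = m k) ->
    agree (ig M) (ia M) m -> (32 <= t)%nat -> (t < 64)%nat ->
    exists m',
      runs (icode a t ++ icode b (S t) ++ [op t t (S t)]) (r, m) = (r, m') /\
      m' t = g (ieval a M) (ieval b M) /\
      forall k, (k < t \/ 64 <= k)%nat -> m' k = m k).
  { intros a b op g Hop t M r m (m1 & E1 & V1 & F1) Hb Hag Ht Ht'.
    destruct (Hb m1) as (m2 & E2 & V2 & F2).
    { eapply agree_frame; [exact Hag|]. intros; apply F1; lia. }
    rewrite !runs_app, E1, E2. unfold runs; cbn [fold_left].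
    rewrite Hop; cbn [fst snd].
    eexists; split; [reflexivity|]. split.
    - rewrite upd_same, V2, F2, V1 by lia. reflexivity.
    - intros k Hk. rewrite upd_other, F2, F1 by lia. reflexivity. }
  induction e as [z|k0|a IHa b IHb|a IHa b IHb|a IHa|f a IHa];
    intros t M r m Hag Ht Hw Hs; cbn [icode]; cbn -[Nat.ltb] in Hw, Hs;
    pose proof Hw as Hw0; bools Hw.
  - eexists; split; [reflexivity|]. split; intros; upd_simpl; auto.
  - eexists; split; [reflexivity|]. split; intros; upd_simpl; auto.
    rewrite (proj1 Hag) by lia. cbn. lia.
  - destruct Hs. apply (BIN a b IAdd Z.add); auto.
    + now intros [].
    + now apply iwf_bound with a.
  - destruct Hs. apply (BIN a b ISub Z.sub); auto.
    + now intros [].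
    + now apply iwf_bound with a.
  - destruct (IHa t M r m) as (m1 & E1 & V1 & F1); auto.
    rewrite runs_app, E1. eexists; split; [reflexivity|].
    apply iwf_bound in Hw.
    split; intros; upd_simpl; rewrite ?V1; auto.
  - destruct Hs as [Hs Hpos].
    destruct (IHa t M r m) as (m1 & E1 & V1 & F1); auto.
    destruct (cell_addr_ok f t r m1) as (m2 & E2 & V2 & F2); try lia.
    rewrite !runs_app, E1, E2. eexists; split; [reflexivity|].
    split.
    + upd_simpl. rewrite V2, V1, F2, F1 by lia.
      cbn [ieval]. rewrite <- (proj2 Hag) by lia. f_equal; lia.
    + intros k Hk. upd_simpl. rewrite F2, F1 by lia. reflexivity.
Qed.

Lemma rwf_bound e : forall t, rwf e t = true -> (t < 64)%nat.
Proof. induction e; cbn -[Nat.ltb]; intros t H; bools H; auto. Qed.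

Lemma rcode_ok e : forall t M r m,
  agree (rg M) (ra M) r -> agree (ig M) (ia M) m ->
  (32 <= t)%nat -> rwf e t = true -> rsafe e M ->
  exists r' m', runs (rcode e t) (r, m) = (r', m') /\ r' t = reval e M /\
    (forall k, (k < t \/ 64 <= k)%nat -> r' k = r k) /\
    (forall k, (k < 32 \/ 64 <= k)%nat -> m' k = m k).
Proof.
  induction e as [z|k0|o a IHa b IHb|f a];
    intros t M r m Hr Hm Ht Hw Hs; cbn [rcode]; cbn -[Nat.ltb] in Hw, Hs;
    pose proof Hw as Hw0; bools Hw.
  - do 2 eexists; split; [reflexivity|]. repeat split; intros; upd_simpl; auto.
  - do 2 eexists; split; [reflexivity|]. repeat split; intros; upd_simpl; auto.
    rewrite (proj1 Hr) by lia. cbn. ring.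
  - destruct Hs.
    destruct (IHa t M r m) as (r1 & m1 & E1 & V1 & F1 & G1); auto.
    destruct (IHb (S t) M r1 m1) as (r2 & m2 & E2 & V2 & F2 & G2); auto.
    { eapply agree_frame; [exact Hr|]. intros; apply F1; lia. }
    { eapply agree_frame; [exact Hm|]. intros; apply G1; lia. }
    apply rwf_bound in Hw.
    rewrite !runs_app, E1, E2. exists (upd r2 t (rop_fun o (r2 t) (r2 (S t)))), m2.
    split; [destruct o; reflexivity|]. repeat split.
    + upd_simpl. rewrite V2, F2, V1 by lia. reflexivity.
    + intros k Hk. upd_simpl. rewrite F2, F1 by lia. reflexivity.
    + intros k Hk. rewrite G2, G1 by lia. reflexivity.
  - destruct Hs as [Hs Hpos].
    destruct (icode_ok a 32 M r m) as (m1 & E1 & V1 & F1); auto.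
    destruct (cell_addr_ok f 32 r m1) as (m2 & E2 & V2 & F2); try lia.
    rewrite !runs_app, E1, E2. do 2 eexists; split; [reflexivity|].
    repeat split.
    + upd_simpl. rewrite V2, V1.
      cbn [reval]. rewrite <- (proj2 Hr) by lia. f_equal; lia.
    + intros k Hk. upd_simpl. reflexivity.
    + intros k Hk. rewrite F2, F1 by lia. reflexivity.
Qed.

Lemma icode_straight e : forall t, forallb straight (icode e t) = true.
Proof.
  induction e; intros t; cbn [icode]; rewrite ?forallb_app; cbn;
    rewrite ?IHe, ?IHe1, ?IHe2; reflexivity.
Qed.

Lemma rcode_straight e : forall t, forallb straight (rcode e t) = true.
Proof.
  induction e as [| |o| ]; intros t; cbn [rcode]; rewrite ?forallb_app; cbn;
    rewrite ?icode_straight, ?IHe, ?IHe1, ?IHe2; try reflexivity.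
  destruct o; reflexivity.
Qed.

Inductive cmd :=
| Skip
| SetR (k : nat) (e : rexp)
| SetI (k : nat) (e : iexp)
| StR (f : nat) (a : iexp) (e : rexp)
| StI (f : nat) (a : iexp) (e : iexp)
| Seq (c1 c2 : cmd)
| IfR (a b : rexp) (c1 c2 : cmd)
| IfI (a b : iexp) (c1 c2 : cmd)
| While (a b : iexp) (c : cmd).

Definition set_rg M k v := Mem (upd (rg M) k v) (ig M) (ra M) (ia M).
Definition set_ig M k v := Mem (rg M) (upd (ig M) k v) (ra M) (ia M).
Definition set_ra M f i v := Mem (rg M) (ig M) (upd2 (ra M) f i v) (ia M).
Definition set_ia M f i v := Mem (rg M) (ig M) (ra M) (upd2 (ia M) f i v).

Definition basic (c : cmd) : list instr :=
  match c with
  | SetR k e => rcode e 32 ++ [RConst 33 0; RAdd k 32 33]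
  | SetI k e => icode e 32 ++ [IConst 33 0; IAdd k 32 33]
  | StR f a e => rcode e 32 ++ icode a 32 ++ cell_addr f 32 ++ [RStore 32 32]
  | StI f a e => icode e 32 ++ icode a 33 ++ cell_addr f 33 ++ [IStore 33 32]
  | _ => []
  end.

Definition test_code (c : cmd) : list instr :=
  match c with
  | IfR a b _ _ => rcode a 32 ++ rcode b 33
  | IfI a b _ _ | While a b _ => icode a 32 ++ icode b 33
  | _ => []
  end.

Fixpoint size (c : cmd) : nat :=
  match c with
  | Seq c1 c2 => size c1 + size c2
  | IfR _ _ c1 c2 | IfI _ _ c1 c2 =>
      length (test_code c) + 1 + (size c2 + 1 + size c1)
  | While _ _ c1 => length (test_code c) + 2 + (size c1 + 1)
  | _ => length (basic c)
  end.

(** Jump targets are absolute, hence the offset [o]. The branch for a failed test comes first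
    because the conditional jump is taken when the test succeeds. *)
Fixpoint code (c : cmd) (o : nat) : list instr :=
  let o1 := (o + length (test_code c))%nat in
  match c with
  | Seq c1 c2 => code c1 o ++ code c2 (o + size c1)
  | IfR _ _ c1 c2 =>
      test_code c ++ [RJmpLt 32 33 (o1 + 1 + (size c2 + 1))]
      ++ code c2 (o1 + 1) ++ [Jmp (o + size c)]
      ++ code c1 (o1 + 1 + (size c2 + 1))
  | IfI _ _ c1 c2 =>
      test_code c ++ [IJmpLt 32 33 (o1 + 1 + (size c2 + 1))]
      ++ code c2 (o1 + 1) ++ [Jmp (o + size c)]
      ++ code c1 (o1 + 1 + (size c2 + 1))
  | While _ _ c1 =>
      test_code c ++ [IJmpLt 32 33 (o1 + 2); Jmp (o + size c)]
      ++ code c1 (o1 + 2) ++ [Jmp o]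
  | _ => basic c
  end.

Lemma code_length c : forall o, length (code c o) = size c.
Proof.
  induction c; intros o; cbn [code]; rewrite ?length_app;
    cbn [length]; rewrite ?length_app; cbn [length];
    rewrite ?IHc, ?IHc1, ?IHc2; cbn [size]; try reflexivity; lia.
Qed.

Fixpoint cwf (c : cmd) : bool :=
  match c with
  | Skip => true
  | SetR k e => Nat.ltb k 32 && rwf e 32
  | SetI k e => Nat.ltb k 32 && iwf e 32
  | StR f a e => Nat.ltb f 16 && iwf a 32 && rwf e 32
  | StI f a e => Nat.ltb f 16 && iwf a 33 && iwf e 32
  | Seq c1 c2 => cwf c1 && cwf c2
  | IfR a b c1 c2 => rwf a 32 && rwf b 33 && cwf c1 && cwf c2
  | IfI a b c1 c2 => iwf a 32 && iwf b 33 && cwf c1 && cwf c2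
  | While a b c1 => iwf a 32 && iwf b 33 && cwf c1
  end.

(** The number is the exact count of executed instructions: the extra units are the conditional
    jump, the jump past the other branch after a failed test, and the jumps that repeat or leave a
    loop. *)
Inductive ev : cmd -> mem -> nat -> mem -> Prop :=
| ev_skip M : ev Skip M 0 M
| ev_setR k e M : rsafe e M ->
    ev (SetR k e) M (length (basic (SetR k e))) (set_rg M k (reval e M))
| ev_setI k e M : isafe e M ->
    ev (SetI k e) M (length (basic (SetI k e))) (set_ig M k (ieval e M))
| ev_stR f a e M : isafe a M -> (0 <= ieval a M)%Z -> rsafe e M ->
    ev (StR f a e) M (length (basic (StR f a e)))
       (set_ra M f (Z.to_nat (ieval a M)) (reval e M))
| ev_stI f a e M : isafe a M -> (0 <= ieval a M)%Z -> isafe e M ->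
    ev (StI f a e) M (length (basic (StI f a e)))
       (set_ia M f (Z.to_nat (ieval a M)) (ieval e M))
| ev_seq c1 c2 M n1 M1 n2 M2 : ev c1 M n1 M1 -> ev c2 M1 n2 M2 ->
    ev (Seq c1 c2) M (n1 + n2) M2
| ev_ifR_true a b c1 c2 M n M' : rsafe a M -> rsafe b M ->
    (reval a M < reval b M)%R -> ev c1 M n M' ->
    ev (IfR a b c1 c2) M (length (test_code (IfR a b c1 c2)) + (1 + n)) M'
| ev_ifR_false a b c1 c2 M n M' : rsafe a M -> rsafe b M ->
    ~ (reval a M < reval b M)%R -> ev c2 M n M' ->
    ev (IfR a b c1 c2) M (length (test_code (IfR a b c1 c2)) + (1 + (n + 1))) M'
| ev_ifI_true a b c1 c2 M n M' : isafe a M -> isafe b M ->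
    (ieval a M < ieval b M)%Z -> ev c1 M n M' ->
    ev (IfI a b c1 c2) M (length (test_code (IfI a b c1 c2)) + (1 + n)) M'
| ev_ifI_false a b c1 c2 M n M' : isafe a M -> isafe b M ->
    ~ (ieval a M < ieval b M)%Z -> ev c2 M n M' ->
    ev (IfI a b c1 c2) M (length (test_code (IfI a b c1 c2)) + (1 + (n + 1))) M'
| ev_while_true a b c M n1 M1 n2 M2 : isafe a M -> isafe b M ->
    (ieval a M < ieval b M)%Z -> ev c M n1 M1 ->
    ev (While a b c) M1 n2 M2 ->
    ev (While a b c) M
       (length (test_code (While a b c)) + (1 + (n1 + (1 + n2)))) M2
| ev_while_false a b c M : isafe a M -> isafe b M ->
    ~ (ieval a M < ieval b M)%Z ->
    ev (While a b c) M (length (test_code (While a b c)) + (1 + 1)) M.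

Lemma agree_upd {A} (reg : nat -> A) arr c k v :
  agree reg arr c -> (k < 32)%nat -> agree (upd reg k v) arr (upd c k v).
Proof.
  intros [H1 H2] Hk. split.
  - intros j Hj. unfold upd. destruct (Nat.eqb j k); auto.
  - intros f i Hf. rewrite upd_other by lia. auto.
Qed.

Lemma agree_upd2 {A} (reg : nat -> A) arr c f i v :
  agree reg arr c -> (f < 16)%nat ->
  agree reg (upd2 arr f i v) (upd c (64 + 16 * i + f)%nat v).
Proof.
  intros [H1 H2] Hf. split.
  - intros j Hj. rewrite upd_other by lia. auto.
  - intros f' i' Hf'. unfold upd2.
    destruct (Nat.eqb_spec f' f) as [->|N]; cbn [andb].
    + destruct (Nat.eqb_spec i' i) as [->|N'].
      * apply upd_same.
      * rewrite upd_other by lia. auto.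
    + rewrite upd_other by lia. auto.
Qed.

Lemma basic_straight c : forallb straight (basic c) = true.
Proof.
  destruct c; cbn [basic]; rewrite ?forallb_app, ?rcode_straight, ?icode_straight;
    reflexivity.
Qed.

Lemma test_straight c : forallb straight (test_code c) = true.
Proof.
  destruct c; cbn [test_code];
    rewrite ?forallb_app, ?rcode_straight, ?icode_straight; reflexivity.
Qed.

Lemma setR_ok k e M q : agreeM M q -> cwf (SetR k e) = true -> rsafe e M ->
  agreeM (set_rg M k (reval e M)) (runs (basic (SetR k e)) q).
Proof.
  destruct q as [r m]. intros [Hr Hm] Hw Hs. cbn -[Nat.ltb] in Hr, Hm, Hw. bools Hw.
  destruct (rcode_ok e 32 M r m) as (r1 & m1 & E1 & V1 & F1 & G1); auto.
  cbn [basic]. rewrite runs_app, E1. unfold runs; cbn [fold_left exec1].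
  split; cbn [fst snd set_rg set_ig set_ra set_ia rg ig ra ia].
  - rewrite upd_same, upd_other, V1 by lia. rewrite Rplus_0_r.
    apply agree_upd; [|exact Hw]. eapply agree_frame; [exact Hr|].
    intros j Hj. rewrite upd_other, F1 by lia. reflexivity.
  - eapply agree_frame; [exact Hm | exact G1].
Qed.

Lemma setI_ok k e M q : agreeM M q -> cwf (SetI k e) = true -> isafe e M ->
  agreeM (set_ig M k (ieval e M)) (runs (basic (SetI k e)) q).
Proof.
  destruct q as [r m]. intros [Hr Hm] Hw Hs. cbn -[Nat.ltb] in Hr, Hm, Hw. bools Hw.
  destruct (icode_ok e 32 M r m) as (m1 & E1 & V1 & F1); auto.
  cbn [basic]. rewrite runs_app, E1. unfold runs; cbn [fold_left exec1].
  split; cbn [fst snd set_rg set_ig set_ra set_ia rg ig ra ia]; [exact Hr|].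
  rewrite upd_same, upd_other, V1 by lia. rewrite Z.add_0_r.
  apply agree_upd; [|exact Hw]. eapply agree_frame; [exact Hm|].
  intros j Hj. rewrite upd_other, F1 by lia. reflexivity.
Qed.

Lemma stR_ok f a e M q : agreeM M q -> cwf (StR f a e) = true ->
  isafe a M -> (0 <= ieval a M)%Z -> rsafe e M ->
  agreeM (set_ra M f (Z.to_nat (ieval a M)) (reval e M))
         (runs (basic (StR f a e)) q).
Proof.
  destruct q as [r m]. intros [Hr Hm] Hw Ha Hp Hs. cbn -[Nat.ltb] in Hr, Hm, Hw. bools Hw.
  destruct (rcode_ok e 32 M r m) as (r1 & m1 & E1 & V1 & F1 & G1); auto.
  destruct (icode_ok a 32 M r1 m1) as (m2 & E2 & V2 & F2); auto.
  { eapply agree_frame; eassumption. }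
  destruct (cell_addr_ok f 32 r1 m2) as (m3 & E3 & V3 & F3); try lia.
  cbn [basic]. rewrite !runs_app, E1, E2, E3.
  unfold runs; cbn [fold_left exec1]. split; cbn [fst snd set_rg set_ig set_ra set_ia rg ig ra ia].
  - rewrite V1, V3, V2.
    replace (Z.to_nat (64 + 16 * ieval a M + Z.of_nat f))
      with (64 + 16 * Z.to_nat (ieval a M) + f)%nat by lia.
    apply agree_upd2; [|lia]. eapply agree_frame; [exact Hr | exact F1].
  - eapply agree_frame; [exact Hm|].
    intros j Hj. rewrite F3, F2, G1 by lia. reflexivity.
Qed.

Lemma stI_ok f a e M q : agreeM M q -> cwf (StI f a e) = true ->
  isafe a M -> (0 <= ieval a M)%Z -> isafe e M ->
  agreeM (set_ia M f (Z.to_nat (ieval a M)) (ieval e M))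
         (runs (basic (StI f a e)) q).
Proof.
  destruct q as [r m]. intros [Hr Hm] Hw Ha Hp Hs. cbn -[Nat.ltb] in Hr, Hm, Hw. bools Hw.
  destruct (icode_ok e 32 M r m) as (m1 & E1 & V1 & F1); auto.
  destruct (icode_ok a 33 M r m1) as (m2 & E2 & V2 & F2); auto; try lia.
  { eapply agree_frame; eassumption. }
  destruct (cell_addr_ok f 33 r m2) as (m3 & E3 & V3 & F3); try lia.
  cbn [basic]. rewrite !runs_app, E1, E2, E3.
  unfold runs; cbn [fold_left exec1]. split; cbn [fst snd set_rg set_ig set_ra set_ia rg ig ra ia]; [exact Hr|].
  rewrite V3, V2, F3, F2, V1 by lia.
  replace (Z.to_nat (64 + 16 * ieval a M + Z.of_nat f))
    with (64 + 16 * Z.to_nat (ieval a M) + f)%nat by lia.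
  apply agree_upd2; [|lia]. eapply agree_frame; [exact Hm|].
  intros j Hj. rewrite F3, F2, F1 by lia. reflexivity.
Qed.

Lemma testR_ok a b M q : agreeM M q -> rwf a 32 = true -> rwf b 33 = true ->
  rsafe a M -> rsafe b M ->
  exists r m, runs (rcode a 32 ++ rcode b 33) q = (r, m) /\
    agreeM M (r, m) /\ r 32%nat = reval a M /\ r 33%nat = reval b M.
Proof.
  destruct q as [r m]. intros [Hr Hm] Ha Hb Sa Sb. cbn in Hr, Hm.
  destruct (rcode_ok a 32 M r m) as (r1 & m1 & E1 & V1 & F1 & G1); auto.
  assert (Hr1 : agree (rg M) (ra M) r1) by (eapply agree_frame; eassumption).
  assert (Hm1 : agree (ig M) (ia M) m1) by (eapply agree_frame; eassumption).
  destruct (rcode_ok b 33 M r1 m1) as (r2 & m2 & E2 & V2 & F2 & G2); auto; try lia.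
  exists r2, m2. rewrite runs_app, E1, E2. repeat split; cbn.
  - apply (agree_frame _ _ r1 r2 Hr1). intros; apply F2; lia.
  - apply (agree_frame _ _ r1 r2 Hr1). intros; apply F2; lia.
  - apply (agree_frame _ _ m1 m2 Hm1). intros; apply G2; lia.
  - apply (agree_frame _ _ m1 m2 Hm1). intros; apply G2; lia.
  - now rewrite F2, V1 by lia.
  - exact V2.
Qed.

Lemma testI_ok a b M q : agreeM M q -> iwf a 32 = true -> iwf b 33 = true ->
  isafe a M -> isafe b M ->
  exists r m, runs (icode a 32 ++ icode b 33) q = (r, m) /\
    agreeM M (r, m) /\ m 32%nat = ieval a M /\ m 33%nat = ieval b M.
Proof.
  destruct q as [r m]. intros [Hr Hm] Ha Hb Sa Sb. cbn in Hr, Hm.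
  destruct (icode_ok a 32 M r m) as (m1 & E1 & V1 & F1); auto.
  assert (Hm1 : agree (ig M) (ia M) m1) by (eapply agree_frame; eassumption).
  destruct (icode_ok b 33 M r m1) as (m2 & E2 & V2 & F2); auto; try lia.
  exists r, m2. rewrite runs_app, E1, E2. split; [reflexivity|].
  split; [|split].
  - split; [exact Hr|]. apply (agree_frame _ _ m1 m2 Hm1). intros; apply F2; lia.
  - now rewrite F2, V1 by lia.
  - exact V2.
Qed.

Lemma step_jmp P o l q : nth_error P o = Some (Jmp l) ->
  step P (at_pc o q) = Some (at_pc l q).
Proof. intros H. unfold step; cbn [pc at_pc]. now rewrite H. Qed.

Lemma step_rjmp P o i j l r m : nth_error P o = Some (RJmpLt i j l) ->
  step P (at_pc o (r, m)) =
  Some (at_pc (if Rlt_dec (r i) (r j) then l else S o) (r, m)).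
Proof.
  intros H. unfold step; cbn [pc at_pc]. rewrite H. cbn.
  destruct (Rlt_dec (r i) (r j)); reflexivity.
Qed.

Lemma step_ijmp P o i j l r m : nth_error P o = Some (IJmpLt i j l) ->
  step P (at_pc o (r, m)) =
  Some (at_pc (if Z.ltb (m i) (m j) then l else S o) (r, m)).
Proof.
  intros H. unfold step; cbn [pc at_pc]. rewrite H. reflexivity.
Qed.

Lemma basic_steps c P o q :
  code_at P o (basic c) ->
  steps P (length (basic c)) (at_pc o q)
    (at_pc (o + length (basic c)) (runs (basic c) q)).
Proof. intros H. apply steps_straight; auto using basic_straight. Qed.

Lemma if_code_at P o t j c1 c2 l :
  code_at P o (t ++ [j] ++ code c2 (o + length t + 1) ++ [Jmp l] ++
               code c1 (o + length t + 1 + (size c2 + 1))) ->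
  code_at P o t /\ nth_error P (o + length t) = Some j /\
  code_at P (o + length t + 1) (code c2 (o + length t + 1)) /\
  nth_error P (o + length t + 1 + size c2) = Some (Jmp l) /\
  code_at P (o + length t + 1 + (size c2 + 1))
    (code c1 (o + length t + 1 + (size c2 + 1))).
Proof.
  intros H. apply code_at_app in H as [H1 H].
  apply code_at_cons in H as [H2 H].
  replace (S (o + length t)) with (o + length t + 1)%nat in H by lia.
  apply code_at_app in H as [H3 H]. rewrite code_length in H.
  apply code_at_cons in H as [H4 H].
  replace (S (o + length t + 1 + size c2))
    with (o + length t + 1 + (size c2 + 1))%nat in H by lia.
  auto.
Qed.

(** Induction is on the evaluation, not on the command: the remaining rounds of a loop are a shorter
    evaluation of the same command, compiled at the same position. *)
Theorem compile_ok c M n M' : ev c M n M' -> cwf c = true ->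
  forall P o q, code_at P o (code c o) -> agreeM M q ->
  exists q', agreeM M' q' /\ steps P n (at_pc o q) (at_pc (o + size c) q').
Proof.
  induction 1 as [M|k e M Hs|k e M Hs|f a e M Ha Hp Hs|f a e M Ha Hp Hs
    |c1 c2 M n1 M1 n2 M2 E1 IH1 E2 IH2
    |a b c1 c2 M n M' Sa Sb L E IH|a b c1 c2 M n M' Sa Sb L E IH
    |a b c1 c2 M n M' Sa Sb L E IH|a b c1 c2 M n M' Sa Sb L E IH
    |a b c M n1 M1 n2 M2 Sa Sb L E1 IH1 E2 IH2|a b c M Sa Sb L];
    intros Hw P o q Hc Hag.
  - exists q. split; [exact Hag|]. cbn. rewrite Nat.add_0_r. constructor.
  - eexists; split; [apply setR_ok; eassumption | now apply basic_steps].
  - eexists; split; [apply setI_ok; eassumption | now apply basic_steps].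
  - eexists; split; [apply stR_ok; eassumption | now apply basic_steps].
  - eexists; split; [apply stI_ok; eassumption | now apply basic_steps].
  - cbn [cwf code size] in Hw, Hc |- *. apply andb_prop in Hw as [W1 W2].
    apply code_at_app in Hc as [C1 C2]. rewrite code_length in C2.
    destruct (IH1 W1 P o q C1 Hag) as (q1 & A1 & S1).
    destruct (IH2 W2 P _ q1 C2 A1) as (q2 & A2 & S2).
    exists q2. split; [exact A2|]. rewrite Nat.add_assoc.
    eapply steps_trans; eassumption.
  - cbn [cwf] in Hw. bools Hw. cbn [code] in Hc.
    apply if_code_at in Hc as (C1 & C2 & C3 & C4 & C5).
    destruct (testR_ok a b M q) as (r & m & E1 & A1 & V1 & V2); auto.
    destruct (IH ltac:(assumption) P _ (r, m) C5 A1) as (q' & A' & S').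
    exists q'. split; [exact A'|].
    eapply steps_trans.
    { apply steps_straight; [exact C1|apply test_straight]. }
    cbn [test_code] in *. rewrite E1.
    eapply steps_trans.
    { apply steps_one. apply step_rjmp. exact C2. }
    rewrite V1, V2. destruct (Rlt_dec _ _); [|contradiction].
    replace (o + size (IfR a b c1 c2))%nat with
      (o + length (rcode a 32 ++ rcode b 33) + 1 + (size c2 + 1) + size c1)%nat
      by (cbn [size test_code]; lia).
    exact S'.
  - cbn [cwf] in Hw. bools Hw. cbn [code] in Hc.
    apply if_code_at in Hc as (C1 & C2 & C3 & C4 & C5).
    destruct (testR_ok a b M q) as (r & m & E1 & A1 & V1 & V2); auto.
    destruct (IH ltac:(assumption) P _ (r, m) C3 A1) as (q' & A' & S').
    exists q'. split; [exact A'|].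
    eapply steps_trans.
    { apply steps_straight; [exact C1|apply test_straight]. }
    cbn [test_code] in *. rewrite E1.
    eapply steps_trans.
    { apply steps_one. apply step_rjmp. exact C2. }
    rewrite V1, V2. destruct (Rlt_dec _ _); [contradiction|].
    match goal with |- context [at_pc (S ?x)] => rewrite <- (Nat.add_1_r x) end.
    eapply steps_trans; [exact S'|]. apply steps_one. now apply step_jmp.
  - cbn [cwf] in Hw. bools Hw. cbn [code] in Hc.
    apply if_code_at in Hc as (C1 & C2 & C3 & C4 & C5).
    destruct (testI_ok a b M q) as (r & m & E1 & A1 & V1 & V2); auto.
    destruct (IH ltac:(assumption) P _ (r, m) C5 A1) as (q' & A' & S').
    exists q'. split; [exact A'|].
    eapply steps_trans.
    { apply steps_straight; [exact C1|apply test_straight]. }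
    cbn [test_code] in *. rewrite E1.
    eapply steps_trans.
    { apply steps_one. apply step_ijmp. exact C2. }
    rewrite V1, V2. apply Z.ltb_lt in L as ->.
    replace (o + size (IfI a b c1 c2))%nat with
      (o + length (icode a 32 ++ icode b 33) + 1 + (size c2 + 1) + size c1)%nat
      by (cbn [size test_code]; lia).
    exact S'.
  - cbn [cwf] in Hw. bools Hw. cbn [code] in Hc.
    apply if_code_at in Hc as (C1 & C2 & C3 & C4 & C5).
    destruct (testI_ok a b M q) as (r & m & E1 & A1 & V1 & V2); auto.
    destruct (IH ltac:(assumption) P _ (r, m) C3 A1) as (q' & A' & S').
    exists q'. split; [exact A'|].
    eapply steps_trans.
    { apply steps_straight; [exact C1|apply test_straight]. }
    cbn [test_code] in *. rewrite E1.
    eapply steps_trans.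
    { apply steps_one. apply step_ijmp. exact C2. }
    rewrite V1, V2. apply Z.ltb_nlt in L as ->.
    match goal with |- context [at_pc (S ?x)] => rewrite <- (Nat.add_1_r x) end.
    eapply steps_trans; [exact S'|]. apply steps_one. now apply step_jmp.
  - pose proof Hc as Hc0. pose proof Hw as Hw0. cbn [cwf] in Hw. bools Hw. cbn [code] in Hc.
    apply code_at_app in Hc as [C1 Hc].
    apply code_at_cons in Hc as [C2 Hc]. apply code_at_cons in Hc as [C3 Hc].
    replace (S (S (o + length (test_code (While a b c)))))
      with (o + length (test_code (While a b c)) + 2)%nat in Hc by lia.
    apply code_at_app in Hc as [C4 Hc]. rewrite code_length in Hc.
    apply code_at_cons in Hc as [C5 _].
    destruct (testI_ok a b M q) as (r & m & E & A1 & V1 & V2); auto.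
    destruct (IH1 ltac:(assumption) P _ (r, m) C4 A1) as (q1 & A2 & S1).
    destruct (IH2 Hw0 P o q1 Hc0 A2) as (q2 & A3 & S2).
    exists q2. split; [exact A3|].
    eapply steps_trans.
    { apply steps_straight; [exact C1|apply test_straight]. }
    cbn [test_code] in *. rewrite E.
    eapply steps_trans.
    { apply steps_one. apply step_ijmp. exact C2. }
    rewrite V1, V2. apply Z.ltb_lt in L as ->.
    eapply steps_trans; [exact S1|].
    eapply steps_trans; [apply steps_one, step_jmp; exact C5|]. exact S2.
  - cbn [cwf] in Hw. bools Hw. cbn [code] in Hc.
    apply code_at_app in Hc as [C1 Hc].
    apply code_at_cons in Hc as [C2 Hc]. apply code_at_cons in Hc as [C3 Hc].
    destruct (testI_ok a b M q) as (r & m & E & A1 & V1 & V2); auto.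
    exists (r, m). split; [exact A1|].
    eapply steps_trans.
    { apply steps_straight; [exact C1|apply test_straight]. }
    cbn [test_code] in *. rewrite E.
    eapply steps_trans.
    { apply steps_one. apply step_ijmp. exact C2. }
    rewrite V1, V2. apply Z.ltb_nlt in L as ->.
    apply steps_one. now apply step_jmp.
Qed.

(* A weakest precondition for loop-free commands; computed values are
   generalized so that symbolic execution names them instead of copying them. *)
Fixpoint wp (c : cmd) (Q : mem -> Prop) (M : mem) : Prop :=
  match c with
  | Skip => Q M
  | SetR k e => rsafe e M /\ forall v, v = reval e M -> Q (set_rg M k v)
  | SetI k e => isafe e M /\ forall v, v = ieval e M -> Q (set_ig M k v)
  | StR f a e => (isafe a M /\ (0 <= ieval a M)%Z /\ rsafe e M) /\
      forall v, v = reval e M -> Q (set_ra M f (Z.to_nat (ieval a M)) v)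
  | StI f a e => (isafe a M /\ (0 <= ieval a M)%Z /\ isafe e M) /\
      forall v, v = ieval e M -> Q (set_ia M f (Z.to_nat (ieval a M)) v)
  | Seq c1 c2 => wp c1 (wp c2 Q) M
  | IfR a b c1 c2 => (rsafe a M /\ rsafe b M) /\
      ((reval a M < reval b M)%R -> wp c1 Q M) /\
      (~ (reval a M < reval b M)%R -> wp c2 Q M)
  | IfI a b c1 c2 => (isafe a M /\ isafe b M) /\
      ((ieval a M < ieval b M)%Z -> wp c1 Q M) /\
      (~ (ieval a M < ieval b M)%Z -> wp c2 Q M)
  | While _ _ _ => False
  end.

(** Code without loops only jumps forward, so each instruction is executed at most once and the size
    bounds the cost. *)
Lemma wp_ok c : forall Q M, wp c Q M ->
  exists n M', ev c M n M' /\ (n <= size c)%nat /\ Q M'.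
Proof.
  induction c as [|k e|k e|f a e|f a e|c1 IH1 c2 IH2|a b c1 IH1 c2 IH2
    |a b c1 IH1 c2 IH2|a b c IH]; intros Q M H; cbn [wp] in H.
  - exists 0%nat, M. repeat split; auto. constructor.
  - destruct H as [Hs H]. do 2 eexists. split; [now constructor|].
    split; [apply le_n | now apply H].
  - destruct H as [Hs H]. do 2 eexists. split; [now constructor|].
    split; [apply le_n | now apply H].
  - destruct H as [(Ha & Hp & Hs) H]. do 2 eexists. split; [now constructor|].
    split; [apply le_n | now apply H].
  - destruct H as [(Ha & Hp & Hs) H]. do 2 eexists. split; [now constructor|].
    split; [apply le_n | now apply H].
  - destruct (IH1 _ _ H) as (n1 & M1 & E1 & L1 & H1).
    destruct (IH2 _ _ H1) as (n2 & M2 & E2 & L2 & H2).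
    exists (n1 + n2)%nat, M2. split; [econstructor; eassumption|].
    split; [cbn; lia | exact H2].
  - destruct H as [[Sa Sb] [Ht Hf]].
    destruct (Rlt_dec (reval a M) (reval b M)) as [L|L].
    + destruct (IH1 _ _ (Ht L)) as (n & M' & E & Ln & HQ).
      do 2 eexists. split; [now apply ev_ifR_true with (n := n) (M' := M')|].
      split; [cbn [size]; lia | exact HQ].
    + destruct (IH2 _ _ (Hf L)) as (n & M' & E & Ln & HQ).
      do 2 eexists. split; [now apply ev_ifR_false with (n := n) (M' := M')|].
      split; [cbn [size]; lia | exact HQ].
  - destruct H as [[Sa Sb] [Ht Hf]].
    destruct (Z_lt_dec (ieval a M) (ieval b M)) as [L|L].
    + destruct (IH1 _ _ (Ht L)) as (n & M' & E & Ln & HQ).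
      do 2 eexists. split; [now apply ev_ifI_true with (n := n) (M' := M')|].
      split; [cbn [size]; lia | exact HQ].
    + destruct (IH2 _ _ (Hf L)) as (n & M' & E & Ln & HQ).
      do 2 eexists. split; [now apply ev_ifI_false with (n := n) (M' := M')|].
      split; [cbn [size]; lia | exact HQ].
  - destruct H.
Qed.

(** The index [p] of the invariant is a potential that falls in every round; the added 1 pays for
    the failing test at the end. *)
Lemma wp_while a b c (I : nat -> mem -> Prop) :
  (forall p M, I p M -> isafe a M /\ isafe b M) ->
  (forall p M, I p M -> (ieval a M < ieval b M)%Z ->
     wp c (fun M' => exists p', (p' < p)%nat /\ I p' M') M) ->
  forall p M, I p M ->
  exists n M', ev (While a b c) M n M' /\
    (n <= size (While a b c) * (p + 1))%nat /\
    ~ (ieval a M' < ieval b M')%Z /\ exists p', I p' M'.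
Proof.
  intros Hsafe Hbody p.
  induction p as [p IH] using (well_founded_induction lt_wf). intros M HI.
  destruct (Hsafe p M HI) as [Sa Sb].
  destruct (Z_lt_dec (ieval a M) (ieval b M)) as [L|L].
  - destruct (wp_ok _ _ _ (Hbody p M HI L)) as (n1 & M1 & E1 & L1 & p' & Hp & HI').
    destruct (IH p' Hp M1 HI') as (n2 & M2 & E2 & L2 & HQ).
    do 2 eexists. split; [eapply ev_while_true; eassumption|].
    split; [|exact HQ]. cbn [size] in *.
    set (K := length (test_code (While a b c))) in *. nia.
  - do 2 eexists. split; [now apply ev_while_false|].
    split; [|split; eauto]. cbn [size]. nia.
Qed.

Local Open Scope R_scope.

(** * Polygonal trajectories and blocks *)

Definition vert (V : list vertex) (i : nat) : vertex := nth i V (Vertex 0 0 0).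
Definition posx (V : list vertex) (t : R) : R := fst (Defs.pos V t).
Definition posy (V : list vertex) (t : R) : R := snd (Defs.pos V t).

Lemma vert_time_S V : forall i, times_increasing V -> (S i < length V)%nat ->
  vt (vert V i) < vt (vert V (S i)).
Proof.
  induction V as [|v [|w V] IH]; intros i H Hi; cbn in Hi; try lia.
  destruct H as [H1 H2]. destruct i as [|i]; [exact H1|].
  apply IH; [exact H2 | cbn; lia].
Qed.

Lemma vert_time_le V i j : times_increasing V -> (i <= j < length V)%nat ->
  vt (vert V i) <= vt (vert V j).
Proof.
  intros H [Hij Hj]. induction Hij as [|j Hij IH]; [lra|].
  pose proof (vert_time_S V j H ltac:(lia)). specialize (IH ltac:(lia)). lra.
Qed.

Lemma first_time_vert V : first_time V = vt (vert V 0).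
Proof. destruct V; reflexivity. Qed.

Lemma last_time_vert V : last_time V = vt (vert V (length V - 1)).
Proof.
  unfold last_time, vert. f_equal.
  induction V as [|v [|w V] IH]; try reflexivity.
  change (last (v :: w :: V) (Vertex 0 0 0)) with (last (w :: V) (Vertex 0 0 0)).
  rewrite IH. cbn [length]. now rewrite !Nat.sub_succ, !Nat.sub_0_r.
Qed.

Lemma pos_head v V : times_increasing (v :: V) ->
  Defs.pos (v :: V) (vt v) = (vx v, vy v).
Proof.
  destruct V as [|w V]; [reflexivity|]. intros [H _]. cbn.
  destruct (Rle_dec (vt v) (vt w)); [|lra].
  unfold Rdiv. rewrite Rminus_diag, Rmult_0_l. f_equal; ring.
Qed.

Lemma pos_edge V : forall i t, times_increasing V -> (S i < length V)%nat ->
  vt (vert V i) <= t <= vt (vert V (S i)) ->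
  let v := vert V i in let w := vert V (S i) in
  let lam := (t - vt v) / (vt w - vt v) in
  Defs.pos V t = (vx v + lam * (vx w - vx v), vy v + lam * (vy w - vy v)).
Proof.
  induction V as [|v [|w V] IH]; intros i t H Hi Ht; cbn in Hi; try lia.
  destruct i as [|i].
  - cbn in Ht |- *. destruct (Rle_dec t (vt w)); [reflexivity | lra].
  - pose proof (vert_time_le (v :: w :: V) 1 (S i) H ltac:(cbn; lia)) as Hw.
    change (vert (v :: w :: V) 1) with w in Hw.
    destruct H as [H1 H2]. cbn zeta.
    change (vert (v :: w :: V) (S i)) with (vert (w :: V) i) in *.
    change (vert (v :: w :: V) (S (S i))) with (vert (w :: V) (S i)) in *.
    rewrite <- (IH i t H2 ltac:(cbn; lia) Ht).
    change (Defs.pos (v :: w :: V) t) with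
      (if Rle_dec t (vt w) then
        let lam := (t - vt v) / (vt w - vt v) in
        (vx v + lam * (vx w - vx v), vy v + lam * (vy w - vy v))
       else Defs.pos (w :: V) t).
    (* The recursion can stop one edge too early only at [t = vt w], where both edges pass through
       [w]. *)
    destruct (Rle_dec t (vt w)) as [L|L]; [|reflexivity].
    replace t with (vt w) by lra. rewrite pos_head by exact H2. cbn zeta.
    f_equal; field; lra.
Qed.

(** * Motion of one coordinate along an edge *)

Definition affine_on (f : R -> R) (a b u : R) : Prop :=
  forall t, a <= t <= b -> f t = f a + u * (t - a).

Lemma affine_restrict (f : R -> R) a b w z t0 :
  a <= t0 < b ->
  (forall t, a <= t <= b -> f t = z + (t - a) / (b - a) * (w - z)) ->
  affine_on f t0 b ((f b - f t0) / (b - t0)).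
Proof.
  intros Ht H t Hr. rewrite (H t), (H t0), (H b) by lra. field. lra.
Qed.

(** The slopes are difference quotients from the current time [tau], not from the start of the edge,
    since this is the form in which the scan computes velocities. *)
Lemma edge_affine V j tau : times_increasing V -> (1 <= j < length V)%nat ->
  vt (vert V (j - 1)) <= tau < vt (vert V j) ->
  let w := vert V j in
  posx V (vt w) = vx w /\ posy V (vt w) = vy w /\
  affine_on (posx V) tau (vt w) ((vx w - posx V tau) / (vt w - tau)) /\
  affine_on (posy V) tau (vt w) ((vy w - posy V tau) / (vt w - tau)).
Proof.
  intros HT Hj Ht w.
  set (v := vert V (j - 1)) in *.
  assert (E : forall t, vt v <= t <= vt w ->
    Defs.pos V t = (vx v + (t - vt v) / (vt w - vt v) * (vx w - vx v),
               vy v + (t - vt v) / (vt w - vt v) * (vy w - vy v))).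
  { intros t H. pose proof (pos_edge V (j - 1) t HT ltac:(lia)) as P.
    replace (S (j - 1)) with j in P by lia. exact (P H). }
  assert (Hx : posx V (vt w) = vx w).
  { unfold posx. rewrite E by (fold w in Ht; lra). cbn. field. fold w in Ht. lra. }
  assert (Hy : posy V (vt w) = vy w).
  { unfold posy. rewrite E by (fold w in Ht; lra). cbn. field. fold w in Ht. lra. }
  split; [exact Hx|]. split; [exact Hy|]. rewrite <- Hx, <- Hy. split.
  - apply affine_restrict with (a := vt v) (z := vx v) (w := vx w); [exact Ht|].
    intros t H. unfold posx. now rewrite E.
  - apply affine_restrict with (a := vt v) (z := vy v) (w := vy w); [exact Ht|].
    intros t H. unfold posy. now rewrite E.
Qed.

(** The extremes have to be attained: only then must every square that contains the piece reach both
    of them, which is how [tight_max] rules out longer pieces. *)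
Definition box (f : R -> R) (s g tau lo hi : R) : Prop :=
  (forall r, g <= r <= tau -> lo <= f r <= hi) /\
  (exists r, g <= r <= tau /\ f r = lo) /\
  (exists r, g <= r <= tau /\ f r = hi) /\ hi <= lo + s.

Lemma box_point f s t : 0 < s -> box f s t t (f t) (f t).
Proof.
  intros Hs. split; [|split; [|split]].
  - intros r Hr. replace r with t by lra. lra.
  - exists t. lra.
  - exists t. lra.
  - lra.
Qed.

Lemma box_extend f s g tau lo hi wt u : g <= tau -> tau <= wt ->
  box f s g tau lo hi -> affine_on f tau wt u ->
  Rmax hi (f wt) - Rmin lo (f wt) <= s ->
  box f s g wt (Rmin lo (f wt)) (Rmax hi (f wt)).
Proof.
  intros Hg Hw (B & (r0 & Hr0 & E0) & (r1 & Hr1 & E1) & Hs) A Hd.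
  pose proof (B tau ltac:(lra)) as Bt.
  split; [|split; [|split]].
  - intros r Hr. destruct (Rle_dec r tau) as [L|L].
    + specialize (B r ltac:(lra)).
      pose proof (Rmin_l lo (f wt)). pose proof (Rmax_l hi (f wt)). lra.
    + pose proof (A r ltac:(lra)) as Ar. pose proof (A wt ltac:(lra)) as Aw.
      pose proof (Rmin_l lo (f wt)). pose proof (Rmax_l hi (f wt)).
      pose proof (Rmin_r lo (f wt)). pose proof (Rmax_r hi (f wt)).
      destruct (Rle_dec 0 u); nra.
  - unfold Rmin. destruct (Rle_dec lo (f wt)).
    + exists r0. lra.
    + exists wt. lra.
  - unfold Rmax. destruct (Rle_dec hi (f wt)).
    + exists wt. lra.
    + exists r1. lra.
  - lra.
Qed.

(** The slab consists of the positions that can be added to points with extremes [lo] and [hi]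
    without making their extent exceed [s]. *)
Definition in_slab (f : R -> R) (s lo hi a b : R) : Prop :=
  forall r, a <= r <= b -> hi - s <= f r <= lo + s.

(** A certificate that [t] is the last admissible time: the coordinate is on a wall of the slab and
    keeps moving outwards until [wt]. *)
Definition tight (f : R -> R) (s lo hi tau t wt : R) : Prop :=
  t < wt /\ exists u, affine_on f tau wt u /\
    (0 < u /\ f t = lo + s \/ u < 0 /\ f t = hi - s).

Definition exit_time (tau p wt w z : R) : R := (z - p) * (wt - tau) / (w - p) + tau.

Lemma exit_up f s lo hi tau wt u : tau < wt -> affine_on f tau wt u ->
  lo <= f tau <= hi -> hi <= lo + s -> lo + s < f wt ->
  let c := exit_time tau (f tau) wt (f wt) (lo + s) in
  tau <= c /\ in_slab f s lo hi tau c /\ tight f s lo hi tau c wt.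
Proof.
  intros Ht A B Hs Hw c.
  pose proof (A wt ltac:(lra)) as Aw.
  assert (Hu : 0 < u) by nra.
  assert (Ec : u * (c - tau) = lo + s - f tau).
  { unfold c, exit_time. rewrite Aw. field. nra. }
  assert (Hc : tau <= c) by nra.
  assert (Hcw : c < wt) by nra.
  assert (Fc : f c = lo + s) by (rewrite A by lra; lra).
  split; [exact Hc|]. split.
  - intros r Hr. rewrite A by lra. nra.
  - split; [exact Hcw|]. exists u. auto.
Qed.

Lemma exit_down f s lo hi tau wt u : tau < wt -> affine_on f tau wt u ->
  lo <= f tau <= hi -> hi <= lo + s -> f wt < hi - s ->
  let c := exit_time tau (f tau) wt (f wt) (hi - s) in
  tau <= c /\ in_slab f s lo hi tau c /\ tight f s lo hi tau c wt.
Proof.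
  intros Ht A B Hs Hw c.
  pose proof (A wt ltac:(lra)) as Aw.
  assert (Hu : u < 0) by nra.
  assert (Ec : u * (c - tau) = hi - s - f tau).
  { unfold c, exit_time. rewrite Aw. field. nra. }
  assert (Hc : tau <= c) by nra.
  assert (Hcw : c < wt) by nra.
  assert (Fc : f c = hi - s) by (rewrite A by lra; lra).
  split; [exact Hc|]. split.
  - intros r Hr. rewrite A by lra. nra.
  - split; [exact Hcw|]. exists u. auto.
Qed.

Lemma in_slab_edge f s lo hi tau wt u : tau < wt -> affine_on f tau wt u ->
  lo <= f tau <= hi -> hi <= lo + s -> hi - s <= f wt <= lo + s ->
  in_slab f s lo hi tau wt.
Proof.
  intros Ht A B Hs Hw r Hr. pose proof (A r ltac:(lra)).
  pose proof (A wt ltac:(lra)). destruct (Rle_dec 0 u); nra.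
Qed.

Definition fits1 (f : R -> R) (s c a b : R) : Prop :=
  forall r, a <= r <= b -> c <= f r <= c + s.

(** The motion after [tau] is monotone and starts between [lo] and [hi], so only its end point [f t]
    can enlarge the range; the slab condition keeps the extent within [s]. *)
Lemma hull_fits f s g tau lo hi t wt u : g <= tau -> tau <= t <= wt ->
  box f s g tau lo hi -> affine_on f tau wt u -> in_slab f s lo hi tau t ->
  fits1 f s (Rmin lo (f t)) g t.
Proof.
  intros Hg Ht (B & _ & _ & Hs) A W r Hr.
  pose proof (W t ltac:(lra)) as Wt. pose proof (B tau ltac:(lra)) as Bt.
  destruct (Rle_dec r tau) as [L|L].
  - specialize (B r ltac:(lra)).
    unfold Rmin; destruct (Rle_dec lo (f t)); lra.
  - pose proof (A r ltac:(lra)). pose proof (A t ltac:(lra)).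
    unfold Rmin; destruct (Rle_dec lo (f t)); destruct (Rle_dec 0 u); nra.
Qed.

Lemma tight_max f s g tau lo hi t wt c b : g <= tau -> tau <= t ->
  box f s g tau lo hi -> tight f s lo hi tau t wt -> t < b ->
  ~ fits1 f s c g b.
Proof.
  intros Hg Ht (B & (r0 & Hr0 & E0) & (r1 & Hr1 & E1) & Hs) (Htw & u & A & H) Hb F.
  (* [b] may lie beyond the edge; [r] is a time after [t] that is still on it, where the coordinate
     is more than [s] away from an extreme attained before. *)
  set (r := Rmin b wt).
  assert (Hr : t < r) by (apply Rmin_glb_lt; assumption).
  assert (Hrb : r <= b) by apply Rmin_l.
  assert (Hrw : r <= wt) by apply Rmin_r.
  pose proof (F r ltac:(lra)). pose proof (F r0 ltac:(lra)).
  pose proof (F r1 ltac:(lra)).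
  pose proof (A r ltac:(lra)). pose proof (A t ltac:(lra)).
  destruct H as [[Hu E]|[Hu E]]; nra.
Qed.

(** From [g] the coordinate covers exactly the distance [s] by time [t], and its speed is the same
    on all of the edge. *)
Lemma tight_cap f s g t wt c a b : g <= t ->
  tight f s (f g) (f g) g t wt -> g <= a -> a <= b -> b <= wt ->
  fits1 f s c a b -> b - a <= t - g.
Proof.
  intros Hg (Htw & u & A & H) Ha Hab Hb F.
  pose proof (F a ltac:(lra)). pose proof (F b ltac:(lra)).
  pose proof (A a ltac:(lra)). pose proof (A b ltac:(lra)).
  pose proof (A t ltac:(lra)).
  destruct H as [[Hu E]|[Hu E]]; nra.
Qed.

(** The stretch from [p] to [q] is the translate by [u * (p - g)] of one that starts at [g]. *)
Lemma translate_fits f s c g t wt u p q : affine_on f g wt u ->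
  fits1 f s c g t -> t <= wt -> g <= p -> p <= q -> q <= wt -> q - p <= t - g ->
  fits1 f s (c + u * (p - g)) p q.
Proof.
  intros A F Ht Hp Hpq Hq Hd r Hr.
  pose proof (A r ltac:(lra)). pose proof (F (g + (r - p)) ltac:(lra)).
  pose proof (A (g + (r - p)) ltac:(lra)). nra.
Qed.

(** * Blocks and the invariant of the scan *)

Definition fits (s : R) (V : list vertex) (a b : R) : Prop :=
  exists c, sub_contained s c V a b.

Lemma sub_contained_iff s cx cy V a b :
  sub_contained s (cx, cy) V a b <->
  fits1 (posx V) s cx a b /\ fits1 (posy V) s cy a b.
Proof.
  unfold sub_contained, in_square, fits1, posx, posy. cbn. split.
  - intros H. split; intros r Hr; now apply H.
  - intros [H1 H2] r Hr. split; auto.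
Qed.

Lemma fits_inv s V a b : fits s V a b ->
  exists cx cy, fits1 (posx V) s cx a b /\ fits1 (posy V) s cy a b.
Proof.
  intros [[cx cy] H]. exists cx, cy. now apply sub_contained_iff.
Qed.

(* A block is a stretch [g, e] of the trajectory in which a sub-trajectory
   fits into a square iff its duration is at most [d]; the square moves with
   velocity [(ux, uy)], and no fitting sub-trajectory leads from [g] beyond [e]. *)
Record block (s : R) (V : list vertex) (g e d cx cy ux uy : R) : Prop := {
  block_len : d <= e - g;
  block_dur : 0 <= d;
  block_in : forall p q, g <= p -> p <= q -> q <= e -> q - p <= d ->
    sub_contained s (cx + ux * (p - g), cy + uy * (p - g)) V p q;
  block_cap : forall a b, g <= a -> a <= b -> b <= e -> fits s V a b -> b - a <= d;
  block_max : forall b, e < b -> b <= last_time V -> ~ fits s V g b }.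

(** Invariant of the greedy scan: the block began at [g], time [tau] is reached, and vertex [j]
    comes next. [scan_hi] is strict so that the remaining edge has a nonzero duration to divide
    by. *)
Record scan (s : R) (V : list vertex) (j : nat) (g tau x0 x1 y0 y1 : R) : Prop := {
  scan_j : (1 <= j <= length V)%nat;
  scan_lo : vt (vert V (j - 1)) <= tau;
  scan_hi : (j < length V)%nat -> tau < vt (vert V j);
  scan_end : j = length V -> tau = last_time V;
  scan_g : g <= tau;
  scan_x : box (posx V) s g tau x0 x1;
  scan_y : box (posy V) s g tau y0 y1 }.

Lemma vert_end V j : times_increasing V -> (1 <= j < length V)%nat ->
  (S j = length V -> vt (vert V j) = last_time V) /\
  ((S j < length V)%nat -> vt (vert V j) < vt (vert V (S j))).
Proof.
  intros HT Hj. split; intros H.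
  - rewrite last_time_vert. f_equal. f_equal. lia.
  - now apply vert_time_S.
Qed.

Lemma scan_restart_vertex s V j : 0 < s -> times_increasing V ->
  (1 <= S j <= length V)%nat ->
  let w := vert V j in
  scan s V (S j) (vt w) (vt w) (posx V (vt w)) (posx V (vt w))
    (posy V (vt w)) (posy V (vt w)).
Proof.
  intros Hs HT Hj w. constructor; auto using box_point; try lra.
  - replace (S j - 1)%nat with j by lia. fold w. lra.
  - intros H. now apply vert_time_S.
  - intros H. rewrite last_time_vert. unfold w. f_equal. f_equal. lia.
Qed.

Lemma scan_restart_inner s V j g tau x0 x1 y0 y1 t : 0 < s ->
  scan s V j g tau x0 x1 y0 y1 -> (j < length V)%nat ->
  tau <= t < vt (vert V j) ->
  scan s V j t t (posx V t) (posx V t) (posy V t) (posy V t).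
Proof.
  intros Hs S Hj Ht. destruct S. constructor; auto using box_point; try lra.
  lia.
Qed.

Lemma scan_extend s V j g tau x0 x1 y0 y1 : times_increasing V ->
  scan s V j g tau x0 x1 y0 y1 -> (j < length V)%nat ->
  let w := vert V j in
  Rmax x1 (vx w) - Rmin x0 (vx w) <= s ->
  Rmax y1 (vy w) - Rmin y0 (vy w) <= s ->
  scan s V (S j) g (vt w) (Rmin x0 (vx w)) (Rmax x1 (vx w))
    (Rmin y0 (vy w)) (Rmax y1 (vy w)).
Proof.
  intros HT S Hj w Hx Hy. destruct S.
  destruct (vert_end V j HT ltac:(lia)) as [He Hn].
  destruct (edge_affine V j tau HT ltac:(lia) ltac:(split; auto))
    as (Ex & Ey & Ax & Ay). fold w in Ex, Ey, Ax, Ay, He, Hn.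
  specialize (scan_hi0 Hj). fold w in scan_hi0.
  rewrite <- Ex, <- Ey in *.
  constructor; auto.
  - lia.
  - replace (Datatypes.S j - 1)%nat with j by lia. apply Rle_refl.
  - lra.
  - eapply box_extend; eauto; lra.
  - eapply box_extend; eauto; lra.
Qed.

Section Exit.
Context {s : R} {V : list vertex} {j : nat} {g tau x0 x1 y0 y1 t : R}.
Hypothesis HT : times_increasing V.
Hypothesis S : scan s V j g tau x0 x1 y0 y1.
Hypothesis Hj : (j < length V)%nat.
Hypothesis Ht : tau <= t < vt (vert V j).
Hypothesis Wx : in_slab (posx V) s x0 x1 tau t.
Hypothesis Wy : in_slab (posy V) s y0 y1 tau t.
Hypothesis Tight : tight (posx V) s x0 x1 tau t (vt (vert V j)) \/
  tight (posy V) s y0 y1 tau t (vt (vert V j)).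

Lemma exit_hull : fits1 (posx V) s (Rmin x0 (posx V t)) g t /\
  fits1 (posy V) s (Rmin y0 (posy V t)) g t.
Proof.
  destruct S. destruct (edge_affine V j tau HT ltac:(lia) ltac:(split; auto))
    as (Ex & Ey & Ax & Ay).
  split; eapply hull_fits; eauto; lra.
Qed.

Lemma exit_max b : t < b -> ~ fits s V g b.
Proof.
  intros Hb F. apply fits_inv in F as (cx & cy & Fx & Fy). destruct S.
  destruct Tight as [T|T].
  - eapply tight_max with (f := posx V); eauto. apply Ht.
  - eapply tight_max with (f := posy V); eauto. apply Ht.
Qed.

(** All of the block fits into one square, which therefore stands still. *)
Lemma exit_block :
  block s V g t (t - g) (Rmin x0 (posx V t)) (Rmin y0 (posy V t)) 0 0.
Proof.
  pose proof (scan_g _ _ _ _ _ _ _ _ _ S). constructor; try lra.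
  - intros p q Hp Hpq Hq Hd. rewrite !Rmult_0_l, !Rplus_0_r.
    destruct exit_hull as [Fx Fy]. apply sub_contained_iff.
    split; intros r Hr; [apply Fx | apply Fy]; lra.
  - intros. lra.
  - intros b Hb _. now apply exit_max.
Qed.

(** With [tau = g] no vertex has been passed, so the extremes collapse to a single point and
    [tight_cap] and [translate_fits] apply up to the vertex [w], beyond the exit time [t]. *)
Lemma exit_edge_block : tau = g ->
  let w := vert V j in
  block s V g (vt w) (t - g) (Rmin x0 (posx V t)) (Rmin y0 (posy V t))
    ((vx w - posx V g) / (vt w - g)) ((vy w - posy V g) / (vt w - g)).
Proof.
  intros Eg w. destruct exit_hull as [Hx Hy].
  pose proof exit_max as Hmax. destruct S.
  destruct (edge_affine V j tau HT ltac:(lia) ltac:(split; auto))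
    as (Ex & Ey & Ax & Ay). fold w in Ex, Ey, Ax, Ay, Tight, Ht.
  subst tau.
  assert (B0 : forall f lo hi, box f s g g lo hi -> lo = f g /\ hi = f g).
  { intros f lo hi (_ & (r0 & H0 & E0) & (r1 & H1 & E1) & _).
    replace r0 with g in E0 by lra. replace r1 with g in E1 by lra. auto. }
  destruct (B0 _ _ _ scan_x0) as [Ex0 Ex1].
  destruct (B0 _ _ _ scan_y0) as [Ey0 Ey1].
  constructor; try lra.
  - intros p q Hp Hpq Hq Hd. apply sub_contained_iff. split.
    + eapply translate_fits; eauto; lra.
    + eapply translate_fits; eauto; lra.
  - intros a b Ha Hab Hb F. apply fits_inv in F as (cx & cy & Fx & Fy).
    rewrite Ex0, Ex1, Ey0, Ey1 in Tight. destruct Tight as [T|T].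
    + eapply tight_cap with (f := posx V); eauto. lra.
    + eapply tight_cap with (f := posy V); eauto. lra.
  - intros b Hb _. apply Hmax. lra.
Qed.
End Exit.

(** The trajectory ends here, so [block_max] holds vacuously. *)
Lemma final_block s V g tau x0 x1 y0 y1 : scan s V (length V) g tau x0 x1 y0 y1 ->
  block s V g tau (tau - g) x0 y0 0 0.
Proof.
  intros []. constructor; try lra.
  - intros p q Hp Hpq Hq Hd. rewrite !Rmult_0_l, !Rplus_0_r.
    apply sub_contained_iff. destruct scan_x0 as (Bx & _ & _ & Hx).
    destruct scan_y0 as (By & _ & _ & Hy).
    split; intros r Hr; [specialize (Bx r) | specialize (By r)]; lra.
  - intros. lra.
  - intros b Hb Hl. specialize (scan_end0 eq_refl). lra.
Qed.

(* Field 3 of the real array holds the start of a block, which is also the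
   end of its predecessor; field 4 its duration bound; fields 5, 6 the corner
   and 7, 8 the velocity of its square. *)
Definition blocks (s : R) (V : list vertex) (C : nat -> nat -> R) (m : nat) : Prop :=
  forall k, (k < m)%nat ->
    block s V (C 3%nat k) (C 3%nat (S k)) (C 4%nat k)
      (C 5%nat k) (C 6%nat k) (C 7%nat k) (C 8%nat k).

Lemma blocks_S s V C C' m : blocks s V C m ->
  (forall f k, (k < m)%nat -> C' f k = C f k) -> C' 3%nat m = C 3%nat m ->
  block s V (C' 3%nat m) (C' 3%nat (S m)) (C' 4%nat m)
    (C' 5%nat m) (C' 6%nat m) (C' 7%nat m) (C' 8%nat m) ->
  blocks s V C' (S m).
Proof.
  intros B E E3 Bm k Hk. destruct (Nat.eq_dec k m) as [->|N]; [exact Bm|].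
  (* The end of block [m - 1] is stored at index [m], outside the range on which the arrays are
     assumed equal. *)
  assert (E3' : C' 3%nat (S k) = C 3%nat (S k)).
  { destruct (Nat.eq_dec (S k) m) as [->|N']; [exact E3 | apply E; lia]. }
  rewrite E3', !E by lia. apply B. lia.
Qed.

(** The duration that the block guarantees inside the window; it is negative for a block apart from
    the window. *)
Definition value (C : nat -> nat -> R) (x y : R) (k : nat) : R :=
  Rmin (C 4%nat k) (Rmin y (C 3%nat (S k)) - Rmax x (C 3%nat k)).

Definition answer (C : nat -> nat -> R) (x : R) (k : nat) : R * R :=
  (C 5%nat k + C 7%nat k * (Rmax x (C 3%nat k) - C 3%nat k),
   C 6%nat k + C 8%nat k * (Rmax x (C 3%nat k) - C 3%nat k)).

Section Blocks.
Context {s : R} {V : list vertex} {C : nat -> nat -> R} {m : nat}.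
Hypothesis HB : blocks s V C m.

Lemma blocks_mono i j : (i <= j <= m)%nat -> C 3%nat i <= C 3%nat j.
Proof.
  intros [Hij Hj]. induction Hij as [|j Hij IH]; [lra|].
  destruct (HB j ltac:(lia)) as [Blen Bdur Bin Bcap Bmax]. specialize (IH ltac:(lia)). lra.
Qed.

Lemma fits_sub a b a' b' : fits s V a b -> a <= a' -> b' <= b -> fits s V a' b'.
Proof. intros [c H] Ha Hb. exists c. intros t Ht. apply H. lra. Qed.

Lemma value_cap x y k a b : (k < m)%nat -> x <= a -> C 3%nat k <= a -> a <= b ->
  b <= y -> b <= C 3%nat (S k) -> fits s V a b -> b - a <= value C x y k.
Proof.
  intros Hk Hx Hg Hab Hy He F. destruct (HB k Hk) as [Blen Bdur Bin Bcap Bmax].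
  unfold value. apply Rmin_glb; [now apply Bcap|].
  assert (b <= Rmin y (C 3%nat (S k))) by (apply Rmin_glb; assumption).
  assert (Rmax x (C 3%nat k) <= a) by (apply Rmax_lub; assumption). lra.
Qed.

(** Let block [k] contain [a]. If [b] lies beyond that block, cut at its end: the second part starts
    with block [k + 1], and [block_max] keeps it inside. Each part is bounded by the value of its
    block. *)
Lemma fits_two_blocks x y i j w : (i <= j < m)%nat ->
  C 3%nat i <= x -> y <= C 3%nat (S j) -> C 3%nat m = last_time V -> 0 <= w ->
  (forall k, (i <= k <= j)%nat -> value C x y k <= w) ->
  forall a b, x <= a -> a <= b -> b <= y -> fits s V a b -> b - a <= 2 * w.
Proof.
  intros Hij Hi Hj Hm Hw Hv a b Hxa Hab Hby F.
  (* The last block is closed on the right, since [a] may equal [y] at its very end. *)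
  assert (E : exists k, (i <= k <= j)%nat /\ C 3%nat k <= a /\
    (k = j \/ a < C 3%nat (S k))).
  { clear Hj Hv. destruct Hij as [Hij Hjm].
    induction Hij as [|j Hij IH]; [exists i; repeat split; auto; lra|].
    destruct (Rle_dec (C 3%nat (S j)) a) as [L|L].
    - exists (S j). repeat split; auto; lia.
    - destruct (IH ltac:(lia)) as (k & Hk & Hka & [->|Hk']).
      + exists j. repeat split; try lia; auto. right. lra.
      + exists k. repeat split; auto; lia. }
  destruct E as (k & Hk & Hka & Hk').
  destruct (Rle_dec b (C 3%nat (S k))) as [L|L].
  - pose proof (value_cap x y k a b ltac:(lia) Hxa Hka Hab Hby L F).
    specialize (Hv k Hk). lra.
  - destruct Hk' as [->|Hk']; [lra|].
    destruct (Nat.eq_dec k j) as [->|N]; [lra|].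
    destruct (Rle_dec b (C 3%nat (S (S k)))) as [L'|L'].
    + pose proof (value_cap x y k a (C 3%nat (S k)) ltac:(lia) Hxa Hka
        ltac:(lra) ltac:(lra) ltac:(lra) ltac:(eapply fits_sub; eauto; lra)).
      pose proof (value_cap x y (S k) (C 3%nat (S k)) b ltac:(lia) ltac:(lra)
        ltac:(lra) ltac:(lra) Hby L' ltac:(eapply fits_sub; eauto; lra)).
      pose proof (Hv k Hk). pose proof (Hv (S k) ltac:(lia)). lra.
    + pose proof (blocks_mono (S j) m ltac:(lia)).
      destruct (HB (S k) ltac:(lia)) as [Blen Bdur Bin Bcap Bmax]. exfalso.
      apply (Bmax b); [lra|lra|]. eapply fits_sub; eauto; lra.
Qed.

(** Lets the query compare inner blocks by their stored durations, which do not depend on the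
    window. *)
Lemma value_inner x y i j k : (i < k < j)%nat -> (j <= m)%nat ->
  x <= C 3%nat (S i) -> C 3%nat j <= y -> value C x y k = C 4%nat k.
Proof.
  intros Hk Hj Hx Hy. unfold value.
  pose proof (blocks_mono (S i) k ltac:(lia)).
  pose proof (blocks_mono (S k) j ltac:(lia)).
  destruct (HB k ltac:(lia)) as [Blen Bdur Bin Bcap Bmax].
  rewrite (Rmin_right y), (Rmax_right x), Rmin_left; lra.
Qed.

Lemma answer_contained x y k : (k < m)%nat -> 0 <= value C x y k ->
  exists a b, x <= a /\ a <= b /\ b <= y /\ value C x y k = b - a /\
    sub_contained s (answer C x k) V a b.
Proof.
  intros Hk Hv. destruct (HB k Hk) as [Blen Bdur Bin Bcap Bmax].
  assert (H1 := Rmin_l (C 4%nat k) (Rmin y (C 3%nat (S k)) - Rmax x (C 3%nat k))).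
  assert (H2 := Rmin_r (C 4%nat k) (Rmin y (C 3%nat (S k)) - Rmax x (C 3%nat k))).
  fold (value C x y k) in H1, H2.
  pose proof (Rmin_l y (C 3%nat (S k))). pose proof (Rmin_r y (C 3%nat (S k))).
  pose proof (Rmax_l x (C 3%nat k)). pose proof (Rmax_r x (C 3%nat k)).
  exists (Rmax x (C 3%nat k)), (Rmax x (C 3%nat k) + value C x y k).
  do 4 (split; [lra|]). apply Bin; lra.
Qed.
End Blocks.

(** * From durations to weights *)

Lemma real_lub_between (E : R -> Prop) lo hi d : (forall e, E e -> e <= hi) ->
  E d -> lo <= d -> lo <= real (Lub_Rbar E) <= hi.
Proof.
  intros Hub Hd Hlo. destruct (Lub_Rbar_correct E) as [U L].
  pose proof (L (Finite hi) (fun e He => Hub e He)) as L1.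
  pose proof (U d Hd) as U1.
  (* [real] would turn an infinite supremum into 0; the element [d] and the bound [hi] exclude both
     infinities. *)
  destruct (Lub_Rbar E) as [r| |]; cbn in *; try tauto. lra.
Qed.

Lemma weight_ge s V x y c a b : x <= a -> a <= b -> b <= y ->
  sub_contained s c V a b -> b - a <= weight s V x y c.
Proof.
  intros Ha Hab Hb H. unfold weight.
  apply (real_lub_between _ (b - a) (y - x) (b - a)); [|right; eauto 8|lra].
  intros e [->|(a' & b' & ? & ? & ? & -> & _)]; lra.
Qed.

Lemma hotspot_weight_le s V x y w : 0 <= w ->
  (forall a b, x <= a -> a <= b -> b <= y -> fits s V a b -> b - a <= w) ->
  hotspot_weight s V x y <= w.
Proof.
  intros Hw H.
  assert (Hc : forall c, weight s V x y c <= w).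
  { intros c. apply (real_lub_between _ 0 w 0); [|now left|lra].
    intros e [->|(a & b & Ha & Hab & Hb & -> & Hs)]; [exact Hw|].
    apply H; auto. now exists c. }
  apply (real_lub_between _ (weight s V x y (0, 0)) w (weight s V x y (0, 0))).
  - intros e [c ->]. apply Hc.
  - now exists (0, 0).
  - lra.
Qed.


(** * The greedy scan *)

Lemma wp_mono c : forall (Q R : mem -> Prop) M,
  (forall M', Q M' -> R M') -> wp c Q M -> wp c R M.
Proof.
  induction c; intros Q R M H W; cbn [wp] in *; try tauto.
  - now apply H.
  - destruct W; split; auto.
  - destruct W; split; auto.
  - destruct W; split; auto.
  - destruct W; split; auto.
  - eapply IHc1; [|exact W]. intros M' W'. eapply IHc2; eauto.
  - destruct W as (W0 & W1 & W2). split; [exact W0|]. split; intros; eauto.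
  - destruct W as (W0 & W1 & W2). split; [exact W0|]. split; intros; eauto.
Qed.

Lemma wp_cut c1 c2 (Q R : mem -> Prop) M :
  wp c1 R M -> (forall M', R M' -> wp c2 Q M') -> wp (Seq c1 c2) Q M.
Proof. intros W H. cbn [wp]. eapply wp_mono; eassumption. Qed.

Definition SetMin k a b := IfR a b (SetR k a) (SetR k b).
Definition SetMax k a b := IfR a b (SetR k b) (SetR k a).

Lemma wp_min k a b (Q : mem -> Prop) M : rsafe a M -> rsafe b M ->
  (forall v, v = Rmin (reval a M) (reval b M) -> Q (set_rg M k v)) ->
  wp (SetMin k a b) Q M.
Proof.
  intros Ha Hb H. cbn [wp SetMin].
  split; [auto|]. split; intros L; (split; [assumption|]); intros v ->;
    apply H; unfold Rmin; destruct (Rle_dec _ _); lra.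
Qed.

Lemma wp_max k a b (Q : mem -> Prop) M : rsafe a M -> rsafe b M ->
  (forall v, v = Rmax (reval a M) (reval b M) -> Q (set_rg M k v)) ->
  wp (SetMax k a b) Q M.
Proof.
  intros Ha Hb H. cbn [wp SetMax].
  split; [auto|]. split; intros L; (split; [assumption|]); intros v ->;
    apply H; unfold Rmax; destruct (Rle_dec _ _); lra.
Qed.

Lemma upd2_same {A} (g : nat -> nat -> A) f i v : upd2 g f i v f i = v.
Proof. unfold upd2. now rewrite !Nat.eqb_refl. Qed.

Lemma upd2_other {A} (g : nat -> nat -> A) f i v f' i' :
  f' <> f \/ i' <> i -> upd2 g f i v f' i' = g f' i'.
Proof.
  intros H. unfold upd2.
  destruct (Nat.eqb_spec f' f), (Nat.eqb_spec i' i); try reflexivity; tauto.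
Qed.

(** Variable and field numbers are literals and are compared by computation. Element indices are
    symbolic, so accesses to an updated field are left to [upd2_same] and [upd2_other]. *)
Ltac look :=
  cbn [rg ig ra ia set_rg set_ig set_ra set_ia reval ieval rsafe isafe rop_fun];
  repeat match goal with
  | |- context [upd ?f ?k ?v ?j] =>
      let b := eval cbv in (Nat.eqb j k) in
      match b with
      | true => change (upd f k v j) with v
      | false => change (upd f k v j) with (f j)
      end
  | |- context [upd2 ?g ?f ?i ?v ?f' ?i'] =>
      let b := eval cbv in (Nat.eqb f' f) in
      match b with
      | false => change (upd2 g f i v f' i') with (g f' i')
      end
  end.

Ltac lookm :=
  look;
  repeat match goal with
  | H : rg ?M ?k = _ |- context [rg ?M ?k] => rewrite H
  | H : ig ?M ?k = _ |- context [ig ?M ?k] => rewrite H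
  end;
  rewrite ?Nat2Z.id.

Notation "c1 ;; c2" := (Seq c1 c2) (at level 90, right associativity).

(* Exit time of the edge from (variables) [p] at time 4 to [w] at time 13 from
   the slab of positions compatible with the extremes [lo] and [hi], capped by
   variable 14. *)
Definition exit_expr (p w : nat) (z : rexp) : rexp :=
  ROp OAdd (ROp ODiv (ROp OMul (ROp OSub z (RVar p)) (ROp OSub (RVar 13) (RVar 4)))
              (ROp OSub (RVar w) (RVar p))) (RVar 4).

Definition clip (p w lo hi : nat) : cmd :=
  let zhi := ROp OAdd (RVar lo) (RVar 2) in
  let zlo := ROp OSub (RVar hi) (RVar 2) in
  IfR zhi (RVar w) (SetR 20 (exit_expr p w zhi))
    (IfR (RVar w) zlo (SetR 20 (exit_expr p w zlo)) (SetR 20 (RVar 14))) ;;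
  SetMin 14 (RVar 20) (RVar 14).

(** The same code is run for x and then for y. The alternative [t = rg M 14] means that this
    coordinate does not shorten the cap, so any tightness must come from the other one. *)
Lemma clip_ok f u p w lo hi (Q : mem -> Prop) M :
  let s := rg M 2 in let tau := rg M 4 in let wt := rg M 13 in
  (p < 14)%nat -> (w < 14)%nat -> tau < wt -> affine_on f tau wt u ->
  rg M p = f tau -> rg M w = f wt ->
  rg M lo <= f tau <= rg M hi -> rg M hi <= rg M lo + s ->
  tau <= rg M 14 <= wt ->
  (forall c t : R, tau <= t <= rg M 14 -> in_slab f s (rg M lo) (rg M hi) tau t ->
     t = rg M 14 \/ tight f s (rg M lo) (rg M hi) tau t wt ->
     Q (set_rg (set_rg M 20 c) 14 t)) ->
  wp (clip p w lo hi) Q M.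
Proof.
  intros s tau wt Hp Hw Htau A Ep Ew B Hs HT H.
  assert (K : forall c,
    (tau <= c /\ in_slab f s (rg M lo) (rg M hi) tau c /\
       tight f s (rg M lo) (rg M hi) tau c wt) \/
    (c = rg M 14 /\ in_slab f s (rg M lo) (rg M hi) tau wt) ->
    wp (SetMin 14 (RVar 20) (RVar 14)) Q (set_rg M 20 c)).
  { intros c Hc. apply wp_min; [exact I|exact I|]. look. intros t ->.
    destruct Hc as [(Hc & W & T)|(-> & W)].
    - unfold Rmin. destruct (Rle_dec c (rg M 14)).
      + apply H; [lra|exact W|now right].
      + apply H; [lra| |now left]. intros r Hr. apply W. lra.
    - rewrite Rmin_left by lra. apply H; [lra| |now left].
      intros r Hr. apply W. lra. }
  unfold clip, exit_expr. cbn [wp]. look. fold s. rewrite Ew.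
  split; [tauto|]. split; intros L1.
  - split; [tauto|]. intros c Ec. rewrite Ep in Ec. apply K. left. subst c.
    exact (exit_up f s _ _ tau wt u Htau A B Hs L1).
  - split; [tauto|]. split; intros L2.
    + split; [tauto|]. intros c Ec. rewrite Ep in Ec. apply K. left. subst c.
      exact (exit_down f s _ _ tau wt u Htau A B Hs L2).
    + split; [tauto|]. intros c ->. apply K. right. split; [reflexivity|].
      eapply in_slab_edge; eauto; lra.
Qed.

(* Real variables of the scan: 2 side length; 3 start of the current block;
   4, 5, 6 time and position reached; 7-10 extremes of x and y since the start;
   11, 12, 13 the next vertex; 14 exit time; 15-18 extremes including the next
   vertex; 21, 22 exit position; 23, 24 velocity.  Integer variables: 0 number of
   vertices; 1 index of the next vertex; 2 number of blocks; 3 whether a vertex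
   has been passed since the start of the block. *)
Definition close_block : cmd :=
  SetR 14 (RVar 13) ;;
  clip 5 11 7 8 ;;
  clip 6 12 9 10 ;;
  SetR 23 (ROp ODiv (ROp OSub (RVar 11) (RVar 5)) (ROp OSub (RVar 13) (RVar 4))) ;;
  SetR 24 (ROp ODiv (ROp OSub (RVar 12) (RVar 6)) (ROp OSub (RVar 13) (RVar 4))) ;;
  SetR 21 (ROp OAdd (RVar 5) (ROp OMul (RVar 23) (ROp OSub (RVar 14) (RVar 4)))) ;;
  SetR 22 (ROp OAdd (RVar 6) (ROp OMul (RVar 24) (ROp OSub (RVar 14) (RVar 4)))) ;;
  StR 4 (IVar 2) (ROp OSub (RVar 14) (RVar 3)) ;;
  SetMin 25 (RVar 7) (RVar 21) ;; StR 5 (IVar 2) (RVar 25) ;;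
  SetMin 25 (RVar 9) (RVar 22) ;; StR 6 (IVar 2) (RVar 25) ;;
  IfI (ICst 0) (IVar 3)
    (StR 7 (IVar 2) (RCst 0) ;; StR 8 (IVar 2) (RCst 0) ;;
     SetR 3 (RVar 14) ;; SetR 5 (RVar 21) ;; SetR 6 (RVar 22))
    (StR 7 (IVar 2) (RVar 23) ;; StR 8 (IVar 2) (RVar 24) ;;
     SetR 3 (RVar 13) ;; SetR 5 (RVar 11) ;; SetR 6 (RVar 12) ;;
     SetI 1 (IPlus (IVar 1) (ICst 1))) ;;
  SetR 4 (RVar 3) ;;
  SetR 7 (RVar 5) ;; SetR 8 (RVar 5) ;; SetR 9 (RVar 6) ;; SetR 10 (RVar 6) ;;
  SetI 3 (ICst 0) ;;
  StR 3 (IPlus (IVar 2) (ICst 1)) (RVar 3) ;;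
  SetI 2 (IPlus (IVar 2) (ICst 1)).

Definition extend_block : cmd :=
  SetR 7 (RVar 15) ;; SetR 8 (RVar 16) ;; SetR 9 (RVar 17) ;; SetR 10 (RVar 18) ;;
  SetR 4 (RVar 13) ;; SetR 5 (RVar 11) ;; SetR 6 (RVar 12) ;;
  SetI 1 (IPlus (IVar 1) (ICst 1)) ;; SetI 3 (ICst 1).

Definition scan_body : cmd :=
  SetR 11 (RArr 0 (IVar 1)) ;; SetR 12 (RArr 1 (IVar 1)) ;; SetR 13 (RArr 2 (IVar 1)) ;;
  SetMin 15 (RVar 7) (RVar 11) ;; SetMax 16 (RVar 8) (RVar 11) ;;
  SetMin 17 (RVar 9) (RVar 12) ;; SetMax 18 (RVar 10) (RVar 12) ;;
  SetMax 19 (ROp OSub (RVar 16) (RVar 15)) (ROp OSub (RVar 18) (RVar 17)) ;;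
  IfR (RVar 2) (RVar 19) close_block extend_block.

Definition vertices_stored (V : list vertex) (C : nat -> nat -> R) : Prop :=
  forall i, (i < length V)%nat -> C 0%nat i = vx (vert V i) /\
    C 1%nat i = vy (vert V i) /\ C 2%nat i = vt (vert V i).

(* Each step of the scan either passes a vertex or closes a block that
   contains one passed before (flag [fl]), hence the potential [p]. *)
Record scan_state (s : R) (V : list vertex) (j m fl p : nat) (M : mem) : Prop := {
  ss_n : ig M 0%nat = Z.of_nat (length V);
  ss_j : ig M 1%nat = Z.of_nat j;
  ss_m : ig M 2%nat = Z.of_nat m;
  ss_fl : ig M 3%nat = Z.of_nat fl;
  ss_s : rg M 2%nat = s;
  ss_V : vertices_stored V (ra M);
  ss_scan : scan s V j (rg M 3%nat) (rg M 4%nat)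
    (rg M 7%nat) (rg M 8%nat) (rg M 9%nat) (rg M 10%nat);
  ss_x : rg M 5%nat = posx V (rg M 4%nat);
  ss_y : rg M 6%nat = posy V (rg M 4%nat);
  ss_start : fl = 0%nat -> rg M 4%nat = rg M 3%nat;
  ss_first : ra M 3%nat 0%nat = first_time V;
  ss_g : ra M 3%nat m = rg M 3%nat;
  ss_blocks : blocks s V (ra M) m;
  ss_p : p = (2 * (length V - j) + fl)%nat;
  ss_bound : (fl <= 1 /\ m + p <= 2 * length V - 2)%nat }.

Lemma close_block_ok s V j m fl p M : 0 < s -> times_increasing V ->
  scan_state s V j m fl p M -> (j < length V)%nat ->
  rg M 11%nat = vx (vert V j) -> rg M 12%nat = vy (vert V j) ->
  rg M 13%nat = vt (vert V j) ->
  s < Rmax (Rmax (rg M 8%nat) (vx (vert V j)) - Rmin (rg M 7%nat) (vx (vert V j)))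
           (Rmax (rg M 10%nat) (vy (vert V j)) - Rmin (rg M 9%nat) (vy (vert V j))) ->
  wp close_block (fun M' => exists j' m' fl' p', (p' < p)%nat /\
    scan_state s V j' m' fl' p' M') M.
Proof.
  intros Hs HT [En Ej Em Efl Es HV HS Epx Epy Hst Hf Egm HB Hp Hbd] Hj Ewx Ewy Ewt Hext.
  pose proof (scan_hi _ _ _ _ _ _ _ _ _ HS Hj) as Hwt.
  pose proof (scan_j _ _ _ _ _ _ _ _ _ HS) as Hj1.
  pose proof (scan_lo _ _ _ _ _ _ _ _ _ HS) as Hlo.
  pose proof (scan_g _ _ _ _ _ _ _ _ _ HS) as Hg.
  pose proof (scan_x _ _ _ _ _ _ _ _ _ HS) as Hbx.
  pose proof (scan_y _ _ _ _ _ _ _ _ _ HS) as Hby.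
  destruct (edge_affine V j (rg M 4%nat) HT ltac:(lia) ltac:(split; auto))
    as (Ex & Ey & Ax & Ay).
  pose proof (proj1 Hbx (rg M 4%nat) ltac:(lra)) as Bx.
  pose proof (proj1 Hby (rg M 4%nat) ltac:(lra)) as By.
  pose proof (proj2 (proj2 (proj2 Hbx))) as Dx.
  pose proof (proj2 (proj2 (proj2 Hby))) as Dy.
  unfold close_block. cbn [wp]. look. split; [exact I|]. intros t0 ->.
  eapply clip_ok with (f := posx V); look; try lia; rewrite ?Ewt, ?Es;
    [exact Hwt|exact Ax|exact Epx|congruence|exact Bx|exact Dx|lra|].
  intros c1 t1 Ht1 Wx T1.
  eapply clip_ok with (f := posy V); look; try lia; rewrite ?Ewt, ?Es;
    [exact Hwt|exact Ay|exact Epy|congruence|exact By|exact Dy|lra|].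
  intros c2 t Ht Wy T2.
  assert (Wx' : in_slab (posx V) s (rg M 7%nat) (rg M 8%nat) (rg M 4%nat) t).
  { intros r Hr. apply Wx. lra. }
  (* If neither coordinate shortened the edge, the next vertex would lie in both slabs, against
     [Hext]. *)
  assert (T : t < vt (vert V j) /\
    (tight (posx V) s (rg M 7%nat) (rg M 8%nat) (rg M 4%nat) t (vt (vert V j)) \/
     tight (posy V) s (rg M 9%nat) (rg M 10%nat) (rg M 4%nat) t (vt (vert V j)))).
  { destruct T2 as [->|T2]; [|split; [apply T2|now right]].
    destruct T1 as [->|T1]; [|split; [apply T1|now left]].
    exfalso. specialize (Wx _ (conj (Rlt_le _ _ Hwt) (Rle_refl _))).
    specialize (Wy _ (conj (Rlt_le _ _ Hwt) (Rle_refl _))).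
    rewrite Ex in Wx. rewrite Ey in Wy. revert Hext. apply Rle_not_lt.
    unfold Rmax, Rmin. repeat destruct Rle_dec; lra. }
  destruct T as [Htw T].
  cbn [wp]. lookm.
  split; [tauto|]. intros ux Eux. lookm.
  split; [tauto|]. intros uy Euy. lookm.
  split; [tauto|]. intros px Hpx. lookm.
  split; [tauto|]. intros py Hpy. lookm.
  assert (Epx' : px = posx V t).
  { rewrite Hpx, (Ax t) by lra. rewrite Eux. reflexivity. }
  assert (Epy' : py = posy V t).
  { rewrite Hpy, (Ay t) by lra. rewrite Euy. reflexivity. }
  clear Hpx Hpy. subst px py.
  split; [split; [tauto|split; [lia|tauto]]|]. intros d Ed.
  apply wp_min; [exact I|exact I|]. lookm. intros cx Ecx.
  cbn [wp]. lookm.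
  split; [split; [tauto|split; [lia|tauto]]|]. intros cx' ->.
  apply wp_min; [exact I|exact I|]. lookm. intros cy Ecy.
  cbn [wp]. lookm.
  split; [split; [tauto|split; [lia|tauto]]|]. intros cy' ->.
  lookm.
  assert (Esm : Z.to_nat (Z.of_nat m + 1) = S m) by lia.
  split; [tauto|]. split; intros Hfl.
  (* A vertex was passed: the next block starts at [t] inside the edge, the next vertex stays the
     same, and the potential drops by the flag. *)
  - repeat (lookm; split; [repeat split; first [exact I | lia]|]; intros ? ->).
    exists j, (S m), 0%nat, (2 * (length V - j) + 0)%nat.
    split; [lia|]. constructor; lookm; try rewrite Esm; auto; try lia.
    + eapply scan_restart_inner; eauto; lra.
    + now rewrite upd2_same.
    + apply (blocks_S s V (ra M)); auto.
      * intros f k Hk. now rewrite !upd2_other by lia.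
      * now rewrite !upd2_other by lia.
      * look. rewrite !upd2_same, upd2_other by lia. look.
        rewrite Egm.
        subst d cx cy. eapply exit_block; eauto; lra.
  (* No vertex was passed: the block is stretched to vertex [j], and the potential drops by 2. *)
  - repeat (lookm; split; [repeat split; first [exact I | lia]|]; intros ? ->).
    exists (S j), (S m), 0%nat, (2 * (length V - (S j)) + 0)%nat.
    split; [lia|]. constructor; lookm; try rewrite Esm; auto; try lia.
    + rewrite <- Ex, <- Ey. apply scan_restart_vertex; auto; lia.
    + now rewrite upd2_same.
    + apply (blocks_S s V (ra M)); auto.
      * intros f k Hk. now rewrite !upd2_other by lia.
      * now rewrite !upd2_other by lia.
      * look. rewrite !upd2_same, upd2_other by lia. look.
        rewrite Egm.
        assert (Eg : rg M 4%nat = rg M 3%nat) by (apply Hst; lia).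
        subst d cx cy ux uy. rewrite Eg. eapply exit_edge_block; eauto; lra.
Qed.

Lemma scan_body_ok s V j m fl p M : 0 < s -> times_increasing V ->
  scan_state s V j m fl p M -> (j < length V)%nat ->
  wp scan_body (fun M' => exists j' m' fl' p', (p' < p)%nat /\
    scan_state s V j' m' fl' p' M') M.
Proof.
  intros Hs HT [En Ej Em Efl Es HV HS Epx Epy Hst Hf Egm HB Hp Hbd] Hj.
  destruct (HV j Hj) as (Vx & Vy & Vt).
  pose proof (scan_hi _ _ _ _ _ _ _ _ _ HS Hj) as Hwt.
  pose proof (scan_j _ _ _ _ _ _ _ _ _ HS) as Hj1.
  pose proof (scan_lo _ _ _ _ _ _ _ _ _ HS) as Hlo.
  pose proof (scan_g _ _ _ _ _ _ _ _ _ HS) as Hg.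
  destruct (edge_affine V j (rg M 4%nat) HT ltac:(lia) ltac:(split; auto))
    as (Ex & Ey & Ax & Ay).
  unfold scan_body. cbn [wp]. look. rewrite ?Ej, ?Nat2Z.id.
  split; [lia|]. intros wx Hwx. rewrite Vx in Hwx.
  look. rewrite ?Ej, ?Nat2Z.id.
  split; [lia|]. intros wy Hwy. rewrite Vy in Hwy.
  look. rewrite ?Ej, ?Nat2Z.id.
  split; [lia|]. intros wt Hwt'. rewrite Vt in Hwt'.
  apply wp_min; [exact I|exact I|]. look. intros nx0 Enx0.
  apply wp_max; [exact I|exact I|]. look. intros nx1 Enx1.
  apply wp_min; [exact I|exact I|]. look. intros ny0 Eny0.
  apply wp_max; [exact I|exact I|]. look. intros ny1 Eny1.
  apply wp_max; [cbn; tauto|cbn; tauto|]. look. intros ext Eext.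
  cbn [wp]. look.
  split; [tauto|]. split; intros Hext; rewrite Es in Hext.
  - apply close_block_ok with (j := j) (m := m) (fl := fl); look; auto.
    + constructor; look; auto.
    + now rewrite <- Hwx, <- Hwy, <- Enx0, <- Enx1, <- Eny0, <- Eny1, <- Eext.
  - unfold extend_block. cbn [wp].
    repeat (look; split; [tauto|]; intros ? ->).
    pose proof (Rmax_l (nx1 - nx0) (ny1 - ny0)).
    pose proof (Rmax_r (nx1 - nx0) (ny1 - ny0)).
    exists (S j), m, 1%nat, (2 * (length V - S j) + 1)%nat.
    split; [lia|]. constructor; look; auto; try lia.
    + rewrite Enx0, Enx1, Eny0, Eny1, Hwx, Hwy, Hwt'.
      apply scan_extend with (tau := rg M 4%nat); auto;
        rewrite <- ?Hwx, <- ?Hwy, <- ?Enx0, <- ?Enx1, <- ?Eny0, <- ?Eny1; lra.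
    + now rewrite Hwt', Ex.
    + now rewrite Hwt', Ey.
Qed.

(** * The tournament tree *)

(** Takes the place of [wp] for commands with loops; [k] is a bound on the cost, so that costs can
    be added up. *)
Definition runs_to (c : cmd) (k : nat) (Q : mem -> Prop) (M : mem) : Prop :=
  exists n M', ev c M n M' /\ (n <= k)%nat /\ Q M'.

Lemma runs_to_wp c k Q M : (size c <= k)%nat -> wp c Q M -> runs_to c k Q M.
Proof.
  intros Hk H. destruct (wp_ok c Q M H) as (n & M' & E & L & HQ).
  exists n, M'. split; [exact E|]. split; [lia | exact HQ].
Qed.

Lemma runs_to_seq c1 c2 k1 k2 (Q1 Q2 : mem -> Prop) M : runs_to c1 k1 Q1 M ->
  (forall M', Q1 M' -> runs_to c2 k2 Q2 M') ->
  runs_to (Seq c1 c2) (k1 + k2) Q2 M.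
Proof.
  intros (n1 & M1 & E1 & L1 & H1) H.
  destruct (H M1 H1) as (n2 & M2 & E2 & L2 & H2).
  exists (n1 + n2)%nat, M2. split; [econstructor; eassumption|].
  split; [lia | exact H2].
Qed.

Lemma runs_to_while a b c (I : nat -> mem -> Prop) p (Q : mem -> Prop) M :
  (forall p M, I p M -> isafe a M /\ isafe b M) ->
  (forall p M, I p M -> (ieval a M < ieval b M)%Z ->
     wp c (fun M' => exists p', (p' < p)%nat /\ I p' M') M) ->
  (forall p M, I p M -> ~ (ieval a M < ieval b M)%Z -> Q M) ->
  I p M -> runs_to (While a b c) (size (While a b c) * (p + 1)) Q M.
Proof.
  intros Hs Hb HQ HI.
  destruct (wp_while a b c I Hs Hb p M HI) as (n & M' & E & L & Hn & p' & HI').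
  exists n, M'. split; [exact E|]. split; [exact L | eauto].
Qed.

(* Heap-indexed tournament tree: the leaf [m + k] holds block [k], and an inner
   node [v] the winner of its children [2 v] and [2 v + 1]. *)
Definition node_ok (d : nat -> R) (D : nat -> Z) (m v : nat) : Prop :=
  exists k, D v = Z.of_nat k /\ (k < m)%nat /\
    ((m <= v)%nat -> v = (m + k)%nat) /\
    ((v < m)%nat -> (D v = D (2 * v)%nat \/ D v = D (2 * v + 1)%nat) /\
       d (Z.to_nat (D (2 * v)%nat)) <= d k /\
       d (Z.to_nat (D (2 * v + 1)%nat)) <= d k).

Record prepared (s : R) (V : list vertex) (m : nat) (M : mem) : Prop := {
  pr_m : ig M 2%nat = Z.of_nat m;
  pr_bound : (1 <= m <= 2 * length V)%nat;
  pr_blocks : blocks s V (ra M) m;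
  pr_first : ra M 3%nat 0%nat = first_time V;
  pr_last : ra M 3%nat m = last_time V }.

Definition scan_init : cmd :=
  SetR 3 (RArr 2 (ICst 0)) ;; SetR 4 (RVar 3) ;;
  SetR 5 (RArr 0 (ICst 0)) ;; SetR 6 (RArr 1 (ICst 0)) ;;
  SetR 7 (RVar 5) ;; SetR 8 (RVar 5) ;; SetR 9 (RVar 6) ;; SetR 10 (RVar 6) ;;
  SetI 1 (ICst 1) ;; SetI 2 (ICst 0) ;; SetI 3 (ICst 0) ;;
  StR 3 (ICst 0) (RVar 3).

Definition scan_finish : cmd :=
  StR 4 (IVar 2) (ROp OSub (RVar 4) (RVar 3)) ;;
  StR 5 (IVar 2) (RVar 7) ;; StR 6 (IVar 2) (RVar 9) ;;
  StR 7 (IVar 2) (RCst 0) ;; StR 8 (IVar 2) (RCst 0) ;;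
  StR 3 (IPlus (IVar 2) (ICst 1)) (RVar 4) ;;
  SetI 2 (IPlus (IVar 2) (ICst 1)) ;;
  SetI 4 (IMinus (IPlus (IVar 2) (IVar 2)) (ICst 1)).

(** Nodes are filled from [2 m - 1] down to 1, so both children are ready before their parent. *)
Definition tree_body : cmd :=
  SetI 5 (IPlus (IVar 4) (IVar 4)) ;;
  IfI (IVar 4) (IVar 2)
    (IfR (RArr 4 (IArr 0 (IVar 5))) (RArr 4 (IArr 0 (IPlus (IVar 5) (ICst 1))))
       (StI 0 (IVar 4) (IArr 0 (IPlus (IVar 5) (ICst 1))))
       (StI 0 (IVar 4) (IArr 0 (IVar 5))))
    (StI 0 (IVar 4) (IMinus (IVar 4) (IVar 2))) ;;
  SetI 4 (IMinus (IVar 4) (ICst 1)).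

Definition preprocess : cmd :=
  scan_init ;;
  While (IVar 1) (IVar 0) scan_body ;;
  scan_finish ;;
  While (ICst 0) (IVar 4) tree_body.

Lemma scan_init_ok s V M : 0 < s -> times_increasing V -> (2 <= length V)%nat ->
  ig M 0%nat = Z.of_nat (length V) -> rg M 2%nat = s ->
  vertices_stored V (ra M) ->
  wp scan_init (scan_state s V 1 0 0 (2 * (length V - 1))) M.
Proof.
  intros Hs HT Hn En Es HV. destruct (HV 0%nat ltac:(lia)) as (Vx & Vy & Vt).
  pose proof (scan_restart_vertex s V 0 Hs HT ltac:(lia)) as HS.
  assert (E : posx V (vt (vert V 0)) = vx (vert V 0) /\
              posy V (vt (vert V 0)) = vy (vert V 0)).
  { clear - HT Hn. destruct V as [|v V]; cbn in Hn; [lia|].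
    unfold posx, posy. change (vert (v :: V) 0) with v.
    rewrite pos_head by exact HT. auto. }
  destruct E as [Ex Ey].
  unfold scan_init. cbn [wp].
  repeat (look; split; [repeat split; first [exact I | lia]|]; intros ? ->).
  look. change (Z.to_nat 0) with 0%nat. rewrite Vx, Vy, Vt.
  constructor; look; auto; try lia.
  - cbn zeta in HS. rewrite Ex, Ey in HS. exact HS.
  - rewrite upd2_same. now rewrite first_time_vert.
  - intros k Hk. lia.
Qed.

Lemma scan_finish_ok s V j m fl p M : (2 <= length V)%nat ->
  scan_state s V j m fl p M -> ~ (j < length V)%nat ->
  wp scan_finish (fun M' => prepared s V (S m) M' /\
    ig M' 4%nat = Z.of_nat (2 * S m - 1)) M.
Proof.
  intros Hn [En Ej Em Efl Es HV HS Epx Epy Hst Hf Egm HB Hp Hbd] Hj.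
  assert (Ejn : j = length V) by (pose proof (scan_j _ _ _ _ _ _ _ _ _ HS); lia).
  subst j. pose proof (scan_end _ _ _ _ _ _ _ _ _ HS eq_refl) as Hend.
  assert (Esm : Z.to_nat (Z.of_nat m + 1) = S m) by lia.
  unfold scan_finish. cbn [wp].
  repeat (lookm; split; [repeat split; first [exact I | lia]|]; intros ? ->).
  lookm. rewrite Esm. split; [constructor; look; try lia|look; lia].
  - apply (blocks_S s V (ra M)); auto.
    + intros f k Hk. now rewrite !upd2_other by lia.
    + now rewrite !upd2_other by lia.
    + look. rewrite !upd2_same, upd2_other by lia. look.
      rewrite Egm, <- Hend. eapply final_block; eauto.
  - rewrite upd2_other by lia. exact Hf.
  - apply upd2_same.
Qed.

Definition tree_state s V m (p : nat) (M : mem) : Prop :=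
  prepared s V m M /\ ig M 4%nat = Z.of_nat p /\ (p < 2 * m)%nat /\
  forall v, (p < v < 2 * m)%nat -> node_ok (ra M 4%nat) (ia M 0%nat) m v.

(** The condition at [v] only reads the entries [v], [2 v] and [2 v + 1], all above [p]. *)
Lemma node_ok_upd d D D' m p v : node_ok d D m v -> (p < v)%nat ->
  (forall v, v <> p -> D' v = D v) -> node_ok d D' m v.
Proof.
  intros (k & H1 & H2 & H3 & H4) Hv E. exists k.
  rewrite !E by lia. auto.
Qed.

Lemma tree_body_ok s V m p M : tree_state s V m p M ->
  (0 < ig M 4%nat)%Z ->
  wp tree_body (fun M' => exists p', (p' < p)%nat /\ tree_state s V m p' M') M.
Proof.
  intros ([Em Hbd HB Hf Hl] & E4 & Hp & HN) H0.
  assert (K : forall k i5, node_ok (ra M 4%nat)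
      (upd2 (ia M) 0 p (Z.of_nat k) 0%nat) m p ->
    forall v, v = (Z.of_nat p - 1)%Z -> exists p', (p' < p)%nat /\
      tree_state s V m p' (set_ig (set_ia (set_ig M 5 i5) 0 p (Z.of_nat k)) 4 v)).
  { intros k i5 HK v ->.
    exists (p - 1)%nat. split; [lia|]. split; [constructor; look; auto|].
    look. split; [lia|]. split; [lia|]. intros v Hv.
    destruct (Nat.eq_dec v p) as [->|N]; [exact HK|].
    eapply node_ok_upd with (p := p); [apply HN; lia|lia|].
    intros v' N'. apply upd2_other. now right. }
  assert (C : forall v, upd2 (ia M) 0 p v 0%nat p = v) by (intros; apply upd2_same).
  assert (C' : forall v p', p' <> p -> upd2 (ia M) 0 p v 0%nat p' = ia M 0%nat p')
    by (intros; apply upd2_other; now right).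
  unfold tree_body. cbn [wp]. lookm. split; [tauto|]. intros i5 ->. lookm.
  replace (Z.to_nat (Z.of_nat p + Z.of_nat p)) with (2 * p)%nat by lia.
  replace (Z.to_nat (Z.of_nat p + Z.of_nat p + 1)) with (2 * p + 1)%nat by lia.
  split; [tauto|]. split; intros Hpm.
  - destruct (HN (2 * p)%nat ltac:(lia)) as (a & Ea & Ha & _).
    destruct (HN (2 * p + 1)%nat ltac:(lia)) as (b & Eb & Hb & _).
    rewrite Ea, Eb, !Nat2Z.id. split; [repeat split; lia|].
    split; intros L; (split; [repeat split; lia|]); intros ? ->;
      (split; [tauto|]); apply K.
    + exists b. rewrite C, !C', Ea, Eb, !Nat2Z.id by lia.
      repeat split; auto; try lia; lra.
    + exists a. rewrite C, !C', Ea, Eb, !Nat2Z.id by lia.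
      repeat split; auto; try lia; lra.
  - split; [repeat split; lia|]. intros v Ev.
    replace v with (Z.of_nat (p - m)) by lia.
    split; [tauto|]. apply K.
    exists (p - m)%nat. rewrite C. repeat split; lia.
Qed.

(** The scan starts with potential [2 (n - 1)], and the tree has fewer than [4 n] nodes because
    there are at most [2 n] blocks. *)
Definition preprocess_cost : nat :=
  size scan_init + size scan_finish + 4 * size (While (IVar 1) (IVar 0) scan_body)
  + 4 * size (While (ICst 0) (IVar 4) tree_body).

Lemma preprocess_ok s V M : 0 < s -> times_increasing V -> (2 <= length V)%nat ->
  ig M 0%nat = Z.of_nat (length V) -> rg M 2%nat = s ->
  vertices_stored V (ra M) ->
  runs_to preprocess (preprocess_cost * length V)
    (fun M' => exists m, prepared s V m M' /\
       forall v, (0 < v < 2 * m)%nat -> node_ok (ra M' 4%nat) (ia M' 0%nat) m v) M.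
Proof.
  intros Hs HT Hn En Es HV.
  set (n := length V) in *.
  set (c1 := size (While (IVar 1) (IVar 0) scan_body)).
  set (c2 := size (While (ICst 0) (IVar 4) tree_body)).
  assert (R : runs_to preprocess
    (size scan_init + (c1 * (2 * (n - 1) + 1) + (size scan_finish + c2 * (4 * n))))
    (fun M' => exists m, prepared s V m M' /\
       forall v, (0 < v < 2 * m)%nat -> node_ok (ra M' 4%nat) (ia M' 0%nat) m v) M).
  { eapply runs_to_seq.
    { apply runs_to_wp; [lia|]. now apply scan_init_ok with (s := s) (V := V). }
    intros M1 H1. eapply runs_to_seq.
    { apply runs_to_while with
        (I := fun p M => exists j m fl, scan_state s V j m fl p M)
        (Q := fun M => exists j m fl p, scan_state s V j m fl p M /\ ~ (j < n)%nat).
      - cbn. auto.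
      - intros p M' (j & m & fl & H) L. cbn [ieval] in L.
        rewrite (ss_n _ _ _ _ _ _ _ H), (ss_j _ _ _ _ _ _ _ H) in L.
        eapply wp_mono; [|apply (scan_body_ok s V j m fl p M' Hs HT H); lia].
        intros M2 (j' & m' & fl' & p' & Hp & H'). exists p'. split; [exact Hp|]. eauto.
      - intros p M' (j & m & fl & H) L. cbn [ieval] in L.
        rewrite (ss_n _ _ _ _ _ _ _ H), (ss_j _ _ _ _ _ _ _ H) in L.
        exists j, m, fl, p. split; [exact H | unfold n; lia].
      - eauto. }
    intros M2 (j & m & fl & p & H2 & Hj). eapply runs_to_seq.
    { apply runs_to_wp; [lia|]. eapply scan_finish_ok; eauto. }
    cbn beta. intros M3 [H3 E4].
    assert (Hm : (2 * S m - 1 + 1 <= 4 * n)%nat)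
      by (pose proof (pr_bound _ _ _ _ H3); unfold n; lia).
    destruct (runs_to_while (ICst 0) (IVar 4) tree_body (tree_state s V (S m))
      (2 * S m - 1)
      (fun M' => exists m, prepared s V m M' /\ forall v, (0 < v < 2 * m)%nat ->
         node_ok (ra M' 4%nat) (ia M' 0%nat) m v) M3) as (k & M4 & E & L & HQ).
    - cbn. auto.
    - intros p' M' H' L. now apply tree_body_ok.
    - intros p' M' (H' & Ep & Hp & HN) L. cbn [ieval] in L. rewrite Ep in L.
      exists (S m). split; [exact H'|]. intros v Hv. apply HN. lia.
    - split; [exact H3|]. split; [exact E4|]. split; [lia|]. intros v Hv. lia.
    - exists k, M4. split; [exact E|]. split; [|exact HQ].
      fold c2 in L. nia. }
  destruct R as (k & M' & E & L & HQ). exists k, M'.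
  split; [exact E|]. split; [|exact HQ].
  unfold preprocess_cost. fold c1 c2. nia.
Qed.

(** * Queries *)

Definition bisect_body (z : nat) : cmd :=
  SetI 8 (IHlf (IPlus (IVar 4) (IVar 5))) ;;
  IfR (RVar z) (RArr 3 (IVar 8)) (SetI 5 (IVar 8)) (SetI 4 (IVar 8)).

Definition bisect (z : nat) : cmd :=
  SetI 4 (ICst 0) ;; SetI 5 (IVar 2) ;;
  While (ICst 1) (IMinus (IVar 5) (IVar 4)) (bisect_body z).

(* Variables of the search: 0, 1 the query times; integer 10 the block to evaluate,
   with its value in 12; integer 9 the best block so far, with its value in 3;
   integers 11, 12 the range of tree nodes still to be searched. *)
Definition evaluate : cmd :=
  SetMin 13 (RVar 1) (RArr 3 (IPlus (IVar 10) (ICst 1))) ;;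
  SetMax 11 (RVar 0) (RArr 3 (IVar 10)) ;;
  SetMin 12 (RArr 4 (IVar 10)) (ROp OSub (RVar 13) (RVar 11)).

(** The idle assignment to variable 9 makes both branches update the same variable, so one script
    executes both symbolically. *)
Definition consider : cmd :=
  evaluate ;;
  IfR (RVar 3) (RVar 12) (SetI 9 (IVar 10)) (SetI 9 (IVar 9)) ;;
  SetMax 3 (RVar 3) (RVar 12).

Definition query_init : cmd :=
  SetI 7 (IVar 4) ;;
  SetI 10 (IVar 6) ;; evaluate ;; SetI 9 (IVar 6) ;; SetR 3 (RVar 12) ;;
  SetI 11 (IPlus (IVar 2) (IPlus (IVar 6) (ICst 1))) ;;
  SetI 12 (IPlus (IVar 2) (IVar 7)) ;;
  SetI 10 (IVar 7) ;; consider.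

(** A node is odd iff twice its half is smaller. An odd left end is a right child whose sibling is
    outside the range, so it cannot be represented by its parent and is evaluated by itself. *)
Definition climb_left : cmd :=
  SetI 13 (IHlf (IVar 11)) ;;
  IfI (IPlus (IVar 13) (IVar 13)) (IVar 11)
    (SetI 10 (IArr 0 (IVar 11)) ;; SetI 11 (IPlus (IVar 11) (ICst 1)) ;; consider)
    Skip.

Definition climb_right : cmd :=
  SetI 13 (IHlf (IVar 12)) ;;
  IfI (IPlus (IVar 13) (IVar 13)) (IVar 12)
    (SetI 12 (IMinus (IVar 12) (ICst 1)) ;; SetI 10 (IArr 0 (IVar 12)) ;; consider)
    Skip.

Definition climb : cmd :=
  climb_left ;; climb_right ;;
  SetI 11 (IHlf (IVar 11)) ;; SetI 12 (IHlf (IVar 12)).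

Definition output : cmd :=
  SetMax 10 (RVar 0) (RArr 3 (IVar 9)) ;;
  SetR 11 (ROp OSub (RVar 10) (RArr 3 (IVar 9))) ;;
  SetR 0 (ROp OAdd (RArr 5 (IVar 9)) (ROp OMul (RArr 7 (IVar 9)) (RVar 11))) ;;
  SetR 1 (ROp OAdd (RArr 6 (IVar 9)) (ROp OMul (RArr 8 (IVar 9)) (RVar 11))).

Definition query : cmd :=
  bisect 0 ;; SetI 6 (IVar 4) ;; bisect 1 ;; query_init ;;
  While (IVar 11) (IVar 12) climb ;; output.

Section Query.
Context {s : R} {V : list vertex} {C : nat -> nat -> R} {D : nat -> Z} {m : nat}.
Context {x y : R}.
Hypothesis HB : blocks s V C m.
Hypothesis Hm : (1 <= m)%nat.
Hypothesis Hfirst : C 3%nat 0%nat = first_time V.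
Hypothesis Hlast : C 3%nat m = last_time V.
Hypothesis HD : forall v, (0 < v < 2 * m)%nat -> node_ok (C 4%nat) D m v.
Hypothesis Hx : first_time V <= x.
Hypothesis Hxy : x < y.
Hypothesis Hy : y <= last_time V.

Definition query_data (M : mem) : Prop :=
  rg M 0%nat = x /\ rg M 1%nat = y /\ ig M 2%nat = Z.of_nat m /\
  ra M = C /\ ia M 0%nat = D.

(** Integer variable 6 is carried along because it holds the result of the first bisection during
    the second. *)
Definition bisect_state (z : R) (i6 : Z) (p : nat) (M : mem) : Prop :=
  query_data M /\ ig M 6%nat = i6 /\
  exists lo hi, ig M 4%nat = Z.of_nat lo /\ ig M 5%nat = Z.of_nat hi /\
    (lo < hi <= m)%nat /\ (hi <= lo + 2 ^ p)%nat /\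
    C 3%nat lo <= z <= C 3%nat hi.

Definition block_found (z : R) (r : nat) (M : mem) : Prop :=
  exists k, ig M r = Z.of_nat k /\ (k < m)%nat /\ C 3%nat k <= z <= C 3%nat (S k).

Lemma bisect_body_ok zr z i6 p M : (zr < 2)%nat ->
  rg M zr = z -> bisect_state z i6 p M -> (1 < ig M 5%nat - ig M 4%nat)%Z ->
  wp (bisect_body zr) (fun M' => exists p', (p' < p)%nat /\ 
    (bisect_state z i6 p' M' /\ rg M' zr = z)) M.
Proof.
  intros Hzr Hz ((E0 & E1 & E2 & EC & ED) & E6 & lo & hi & E4 & E5 & Hlh & Hp & Hb) L.
  rewrite E4, E5 in L.
  assert (H0 : (0 < p)%nat) by (destruct p; [cbn in Hp; lia | lia]).
  assert (Hpow : (2 ^ p = 2 * 2 ^ (p - 1))%nat)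
    by (replace p with (S (p - 1)) at 1 by lia; reflexivity).
  unfold bisect_body. cbn [wp]. lookm. split; [tauto|]. intros v8 Ev8.
  assert (Hmid : exists mid, v8 = Z.of_nat mid /\ (2 * mid <= lo + hi)%nat /\
    (lo + hi <= 2 * mid + 1)%nat).
  { exists (Z.to_nat v8). pose proof (Z.div_mod (Z.of_nat lo + Z.of_nat hi) 2 ltac:(lia)).
    pose proof (Z.mod_pos_bound (Z.of_nat lo + Z.of_nat hi) 2 ltac:(lia)). lia. }
  destruct Hmid as (mid & -> & Hmid). lookm. rewrite EC. split; [repeat split; lia|]. split; intros Lz; (split; [tauto|]); intros ? ->.
  - exists (p - 1)%nat. split; [lia|]. split; [|reflexivity].
    split; [repeat split; auto|]. split; [exact E6|].
    exists lo, mid. repeat split; auto; try lia; lra.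
  - exists (p - 1)%nat. split; [lia|]. split; [|reflexivity].
    split; [repeat split; auto|]. split; [exact E6|].
    exists mid, hi. repeat split; auto; try lia; lra.
Qed.

Lemma bisect_ok zr z h M : zr = 0%nat /\ z = x \/ zr = 1%nat /\ z = y ->
  query_data M -> (m <= 2 ^ h)%nat ->
  runs_to (bisect zr) (size (bisect zr) * (h + 1))
    (fun M' => query_data M' /\ ig M' 6%nat = ig M 6%nat /\ block_found z 4 M') M.
Proof.
  intros Hzr (E0 & E1 & E2 & EC & ED) Hh.
  set (w := size (While (ICst 1) (IMinus (IVar 5) (IVar 4)) (bisect_body zr))).
  assert (R : runs_to (bisect zr) (size (SetI 4 (ICst 0)) +
     (size (SetI 5 (IVar 2)) + w * (h + 1)))
    (fun M' => query_data M' /\ ig M' 6%nat = ig M 6%nat /\ block_found z 4 M') M).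
  { eapply runs_to_seq with (Q1 := fun M' => M' = set_ig M 4 0).
    { apply runs_to_wp; [lia|]. cbn [wp]. look. split; [tauto|]. now intros v ->. }
    intros M1 ->.
    eapply runs_to_seq with
      (Q1 := fun M' => M' = set_ig (set_ig M 4 0) 5 (Z.of_nat m)).
    { apply runs_to_wp; [lia|]. cbn [wp]. lookm. split; [tauto|]. now intros v ->. }
    intros M2 ->.
    apply runs_to_while with
      (I := fun p M' => bisect_state z (ig M 6%nat) p M' /\ rg M' zr = z).
    - cbn. tauto.
    - intros p M' [H Hz] L. apply bisect_body_ok; auto. lia.
    - intros p M' [(HQ & E6 & lo & hi & E4 & E5 & Hlh & Hp & Hb) _] L.
      cbn [ieval] in L. rewrite E4, E5 in L.
      split; [exact HQ|]. split; [exact E6|]. exists lo.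
      replace (S lo) with hi by lia. repeat split; auto; try lia; lra.
    - split; [|destruct Hzr as [[-> ->]|[-> ->]]; assumption].
      split; [repeat split; auto|]. split; [reflexivity|].
      exists 0%nat, m. look. repeat split; auto; try lia.
      + rewrite Hfirst. destruct Hzr as [[-> ->]|[-> ->]]; lra.
      + rewrite Hlast. destruct Hzr as [[-> ->]|[-> ->]]; lra. }
  destruct R as (k & M' & E & L & HQ). exists k, M'. split; [exact E|].
  split; [|exact HQ]. unfold bisect. cbn [size] in *. fold w. nia.
Qed.

Definition best_state (b l r : nat) (M : mem) : Prop :=
  query_data M /\ rg M 3%nat = value C x y b /\ ig M 9%nat = Z.of_nat b /\
  (b < m)%nat /\ ig M 11%nat = Z.of_nat l /\ ig M 12%nat = Z.of_nat r.

Lemma evaluate_ok k (Q : mem -> Prop) M : query_data M -> ig M 10%nat = Z.of_nat k ->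
  (forall v13 v11 v12, v12 = value C x y k ->
     Q (set_rg (set_rg (set_rg M 13 v13) 11 v11) 12 v12)) ->
  wp evaluate Q M.
Proof.
  intros (E0 & E1 & E2 & EC & ED) E10 H. unfold evaluate. cbn [wp].
  apply wp_min; lookm; [tauto|repeat split; lia|]. intros v13 E13.
  apply wp_max; lookm; [tauto|repeat split; lia|]. intros v11 E11.
  apply wp_min; lookm; [repeat split; lia|tauto|]. intros v12 E12.
  apply H. rewrite E12, E11, E13, EC.
  replace (Z.to_nat (Z.of_nat k + 1)) with (S k) by lia. reflexivity.
Qed.

Lemma consider_ok b l r k M : best_state b l r M -> ig M 10%nat = Z.of_nat k ->
  (k < m)%nat ->
  wp consider (fun M' => exists b', best_state b' l r M' /\
    value C x y b <= value C x y b' /\ value C x y k <= value C x y b') M.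
Proof.
  intros (HQ & E3 & E9 & Hb & E11 & E12) E10 Hk.
  unfold consider. cbn [wp]. apply evaluate_ok with (k := k); auto.
  intros v13 v11 v12 Ev12. lookm. split; [tauto|].
  destruct HQ as (E0 & E1 & E2 & EC & ED).
  split; intros L; (split; [tauto|]); intros ? ->;
    apply wp_max; look; auto; intros v3 Ev3.
  - exists k. rewrite E3, Rmax_right in Ev3 by lra.
    rewrite <- Ev12. split; [|lra]. repeat split; look; auto. congruence.
  - exists b. rewrite E3, Rmax_left in Ev3 by lra.
    rewrite <- Ev12. split; [|lra]. repeat split; look; auto.
Qed.

Lemma half_nat n : exists h, (Z.of_nat n / 2 = Z.of_nat h)%Z /\
  (n = 2 * h \/ n = 2 * h + 1)%nat.
Proof.
  exists (n / 2)%nat. split; [now rewrite Nat2Z.inj_div|].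
  pose proof (Nat.div_mod n 2 ltac:(lia)).
  pose proof (Nat.mod_upper_bound n 2 ltac:(lia)). lia.
Qed.

Lemma climb_left_ok b l r M : best_state b l r M -> (1 <= l < 2 * m)%nat ->
  wp climb_left (fun M' => exists b' h, best_state b' (2 * h) r M' /\
    value C x y b <= value C x y b' /\
    (l = (2 * h)%nat \/ S l = (2 * h)%nat /\
      value C x y (Z.to_nat (D l)) <= value C x y b')) M.
Proof.
  intros HS Hl. pose proof HS as ((E0 & E1 & E2 & EC & ED) & E3 & E9 & Hb & E11 & E12).
  destruct (half_nat l) as (h & Eh & Hh).
  destruct (HD l ltac:(lia)) as (k & Ek & Hk & _).
  unfold climb_left. cbn [wp]. lookm. rewrite Eh. split; [tauto|]. intros ? ->.
  look. split; [tauto|]. split; intros L.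
  - split; [repeat split; lia|]. intros ? ->. look. split; [tauto|]. intros ? ->.
    rewrite Ek, Nat2Z.id.
    eapply wp_mono; [|apply consider_ok with (b := b) (l := (2 * (h + 1))%nat) (r := r)
      (k := k); auto].
    + intros M' (b' & H' & H1 & H2). exists b', (h + 1)%nat.
      split; [exact H'|]. split; [exact H1|]. right. split; [lia | exact H2].
    + repeat split; look; auto. lia.
    + lookm. now rewrite ED.
  - exists b, h. replace (2 * h)%nat with l by lia. split; [|split; [lra|auto]].
    repeat split; look; auto.
Qed.

Lemma climb_right_ok b l r M : best_state b l r M -> (1 < r <= 2 * m)%nat ->
  wp climb_right (fun M' => exists b' h, best_state b' l (2 * h) M' /\
    value C x y b <= value C x y b' /\
    (r = (2 * h)%nat \/ r = (2 * h + 1)%nat /\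
      value C x y (Z.to_nat (D (2 * h)%nat)) <= value C x y b')) M.
Proof.
  intros HS Hr. pose proof HS as ((E0 & E1 & E2 & EC & ED) & E3 & E9 & Hb & E11 & E12).
  destruct (half_nat r) as (h & Eh & Hh).
  unfold climb_right. cbn [wp]. lookm. rewrite Eh. split; [tauto|]. intros ? ->.
  look. split; [tauto|]. split; intros L.
  - destruct (HD (2 * h)%nat ltac:(lia)) as (k & Ek & Hk & _).
    split; [tauto|]. intros ? ->. look. split; [repeat split; lia|]. intros ? ->.
    assert (Er : Z.to_nat (Z.of_nat r - 1) = (2 * h)%nat) by lia.
    eapply wp_mono; [|apply consider_ok with (b := b) (l := l) (r := (2 * h)%nat)
      (k := k); auto].
    + intros M' (b' & H' & H1 & H2). exists b', h.
      split; [exact H'|]. split; [exact H1|]. right. split; [lia | now rewrite Ek, Nat2Z.id].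
    + repeat split; look; auto. lia.
    + lookm. now rewrite Er, ED.
  - exists b, h. replace (2 * h)%nat with r by lia. split; [|split; [lra|auto]].
    repeat split; look; auto.
Qed.

Section Range.
Context {i j : nat}.
Hypothesis Hij : (i <= j < m)%nat.
Hypothesis Hi : C 3%nat i <= x <= C 3%nat (S i).
Hypothesis Hj : C 3%nat j <= y <= C 3%nat (S j).

(** The range is constrained through the entries [D v] rather than through leaves: unless [m] is a
    power of two, the leaves below a node need not be consecutive. Every block between [i] and [j]
    is beaten by the best one so far or by a winner still in the range. *)
Definition climb_state (p : nat) (M : mem) : Prop :=
  exists b l r, best_state b l r M /\ (1 <= l)%nat /\ (r <= 2 * m)%nat /\
    (r < l + 2 ^ p)%nat /\
    value C x y i <= value C x y b /\ value C x y j <= value C x y b /\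
    (forall v, (l <= v < r)%nat -> (i < Z.to_nat (D v) < j)%nat) /\
    forall k, (i < k < j)%nat -> C 4%nat k <= value C x y b \/
      exists v, (l <= v < r)%nat /\ C 4%nat k <= C 4%nat (Z.to_nat (D v)).

Lemma climb_ok p M : climb_state p M -> (ig M 11%nat < ig M 12%nat)%Z ->
  wp climb (fun M' => exists p', (p' < p)%nat /\ climb_state p' M') M.
Proof.
  intros (b & l & r & HS & Hl & Hr & Hp & Vi & Vj & Hin & Hk) L.
  assert (Elr : (l < r)%nat).
  { destruct HS as (_ & _ & _ & _ & E11 & E12). lia. }
  assert (H0 : (0 < p)%nat) by (destruct p; [cbn in Hp; lia | lia]).
  assert (Hpow : (2 ^ p = 2 * 2 ^ (p - 1))%nat)
    by (replace p with (S (p - 1)) at 1 by lia; reflexivity).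
  unfold climb. eapply wp_cut; [apply climb_left_ok; eauto; lia|].
  intros M1 (b1 & h & HS1 & V1 & C1).
  eapply wp_cut; [apply climb_right_ok; eauto; lia|].
  intros M2 (b2 & g & HS2 & V2 & C2).
  destruct HS2 as ((E0 & E1 & E2 & EC & ED) & E3 & E9 & Hb & E11 & E12).
  cbn [wp]. lookm. split; [tauto|]. intros v1 Ev1. lookm.
  split; [tauto|]. intros v2 Ev2.
  assert (Ev1' : v1 = Z.of_nat h)
    by (rewrite Ev1, Nat2Z.inj_mul, Z.mul_comm; apply Z.div_mul; lia).
  assert (Ev2' : v2 = Z.of_nat g)
    by (rewrite Ev2, Nat2Z.inj_mul, Z.mul_comm; apply Z.div_mul; lia).
  clear Ev1 Ev2. subst v1 v2.
  exists (p - 1)%nat. split; [lia|]. exists b2, h, g.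
  split; [repeat split; look; auto|].
  split; [lia|]. split; [lia|]. split; [lia|]. split; [lra|]. split; [lra|].
  (* Nodes in the range stand for blocks strictly between [i] and [j], which the window does not
     clip. *)
  assert (Inner : forall v, (l <= v < r)%nat ->
    value C x y (Z.to_nat (D v)) = C 4%nat (Z.to_nat (D v))).
  { intros v Hv. eapply value_inner with (j := j); eauto; try lia; lra. }
  split.
  - intros v Hv. destruct (HD v ltac:(lia)) as (k & Ek & Hkm & _ & Hch).
    destruct (Hch ltac:(lia)) as ([E|E] & _); rewrite E; apply Hin; lia.
  (* The node [v] that beats [k] was either an end of the range, whose winner has just been
     considered, or its parent [v / 2] is in the new range with a winner at least as good. *)
  - intros k Hkij. destruct (Hk k Hkij) as [H|(v & Hv & H)]; [left; lra|].
    destruct C1 as [C1|[C1 W1]].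
    2: destruct (Nat.eq_dec v l) as [->|N1];
       [left; rewrite Inner in W1 by lia; lra|].
    all: destruct C2 as [C2|[C2 W2]].
    2, 4: destruct (Nat.eq_dec v (2 * g)) as [->|N2];
       [left; rewrite Inner in W2 by lia; lra|].
    all: right; exists (v / 2)%nat;
      pose proof (Nat.div_mod v 2 ltac:(lia));
      pose proof (Nat.mod_upper_bound v 2 ltac:(lia));
      split; [lia|];
      destruct (HD (v / 2)%nat ltac:(lia)) as (k' & Ek & Hkm & _ & Hch);
      destruct (Hch ltac:(lia)) as (_ & Hl2 & Hr2);
      rewrite Ek, Nat2Z.id;
      (assert (Ev : v = (2 * (v / 2))%nat \/ v = (2 * (v / 2) + 1)%nat) by lia);
      destruct Ev as [Ev|Ev]; rewrite <- Ev in *; lra.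
Qed.

Lemma query_init_ok M : query_data M -> ig M 6%nat = Z.of_nat i ->
  ig M 4%nat = Z.of_nat j -> forall p, (m < 2 ^ p)%nat ->
  wp query_init (climb_state p) M.
Proof.
  intros HQ E6 E4 p Hp. pose proof HQ as (E0 & E1 & E2 & EC & ED).
  unfold query_init. cbn [wp]. lookm. split; [tauto|]. intros ? ->. lookm.
  split; [tauto|]. intros ? ->. apply evaluate_ok with (k := i).
  { repeat split; look; auto. }
  { reflexivity. }
  intros v13 v11 v12 E12. cbn [wp].
  repeat (lookm; split; [tauto|]; intros ? ->). lookm.
  eapply wp_mono; [|apply consider_ok with (b := i) (l := (m + (i + 1))%nat)
    (r := (m + j)%nat) (k := j); [|look; reflexivity|lia]].
  (* These are the leaves strictly between those of [i] and [j]; for [i = j] the left end exceeds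
     the right one and the range is empty. *)
  - intros M' (b & HS & V1 & V2). exists b, (m + (i + 1))%nat, (m + j)%nat.
    split; [exact HS|]. split; [lia|]. split; [lia|]. split; [lia|].
    split; [exact V1|]. split; [exact V2|].
    assert (Hleaf : forall k, (k < m)%nat -> D (m + k)%nat = Z.of_nat k).
    { intros k Hk. destruct (HD (m + k)%nat ltac:(lia)) as (k' & Ek & _ & Hk' & _).
      specialize (Hk' ltac:(lia)). rewrite Ek. f_equal. lia. }
    split.
    + intros v Hv. replace v with (m + (v - m))%nat by lia.
      rewrite Hleaf by lia. lia.
    + intros k Hk. right. exists (m + k)%nat. split; [lia|].
      rewrite Hleaf, Nat2Z.id by lia. lra.
  - repeat split; look; auto; lia.
Qed.

Lemma output_ok p M : climb_state p M -> ~ (ig M 11%nat < ig M 12%nat)%Z ->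
  0 < s ->
  wp output (fun M' => hotspot_weight s V x y <=
    2 * weight s V x y (rg M' 0%nat, rg M' 1%nat)) M.
Proof.
  intros (b & l & r & ((E0 & E1 & E2 & EC & ED) & E3 & E9 & Hb & E11 & E12) & _ & _ &
    _ & Vi & Vj & _ & Hk) L Hs.
  unfold output. cbn [wp]. apply wp_max; [exact I|lookm; repeat split; lia|].
  lookm. rewrite EC. intros v10 E10.
  repeat (lookm; rewrite ?EC; split; [repeat split; first [exact I | lia]|]; intros ? ->).
  look. rewrite E10.
  change (hotspot_weight s V x y <= 2 * weight s V x y (answer C x b)).
  (* Block [i] contains [x], so its value is nonnegative; the best value then is too, as
     [answer_contained] requires. *)
  assert (W0 : 0 <= value C x y i).
  { destruct (HB i ltac:(lia)) as [Blen Bdur _ _ _]. unfold value.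
    rewrite (Rmax_left x) by lra. apply Rmin_glb; [exact Bdur|].
    assert (x <= Rmin y (C 3%nat (S i))) by (apply Rmin_glb; lra). lra. }
  destruct (answer_contained HB x y b Hb ltac:(lra))
    as (a' & b' & Ha' & Hab' & Hb' & Ev & Hsub).
  pose proof (weight_ge s V x y _ a' b' Ha' Hab' Hb' Hsub) as W.
  rewrite <- Ev in W.
  apply Rle_trans with (2 * value C x y b); [|lra].
  apply hotspot_weight_le; [lra|].
  apply (fits_two_blocks HB x y i j); auto; try lra; try lia.
  intros k Hkij.
  destruct (Nat.eq_dec k i) as [->|N1]; [exact Vi|].
  destruct (Nat.eq_dec k j) as [->|N2]; [exact Vj|].
  rewrite (value_inner HB x y i j k) by (lia || lra).
  destruct (Hk k ltac:(lia)) as [H|(v & Hv & _)]; [exact H | lia].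
Qed.
End Range.

Definition query_cost : nat :=
  size (bisect 0) + size (bisect 1) + size (SetI 6 (IVar 4)) + size query_init
  + size (While (IVar 11) (IVar 12) climb) + size output.

Lemma query_ok h M : 0 < s -> query_data M -> (m < 2 ^ h)%nat ->
  runs_to query (query_cost * (h + 1))
    (fun M' => hotspot_weight s V x y <=
       2 * weight s V x y (rg M' 0%nat, rg M' 1%nat)) M.
Proof.
  intros Hs HQ Hh.
  set (w := size (While (IVar 11) (IVar 12) climb)).
  assert (R : runs_to query
    (size (bisect 0) * (h + 1) + (size (SetI 6 (IVar 4)) +
      (size (bisect 1) * (h + 1) + (size query_init + (w * (h + 1) + size output)))))
    (fun M' => hotspot_weight s V x y <=
       2 * weight s V x y (rg M' 0%nat, rg M' 1%nat)) M).
  { eapply runs_to_seq.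
    { apply bisect_ok with (z := x); auto. lia. }
    intros M1 (HQ1 & _ & i & Ei & Him & Hix).
    eapply runs_to_seq with
      (Q1 := fun M' => query_data M' /\ ig M' 6%nat = Z.of_nat i).
    { apply runs_to_wp; [lia|]. cbn [wp]. lookm. split; [tauto|]. intros ? ->.
      split; [|reflexivity]. destruct HQ1 as (? & ? & ? & ? & ?).
      repeat split; look; auto. }
    intros M2 (HQ2 & E6). eapply runs_to_seq.
    { apply bisect_ok with (z := y); auto. lia. }
    intros M3 (HQ3 & E6' & j & Ej & Hjm & Hjy). rewrite E6 in E6'.
    (* Otherwise block [j] would end before block [i] starts, giving [y <= x]. *)
    assert (Hij : (i <= j < m)%nat).
    { split; [|exact Hjm]. destruct (Nat.le_gt_cases i j) as [|Hji]; [assumption|].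
      pose proof (blocks_mono HB (S j) i ltac:(lia)). lra. }
    eapply runs_to_seq.
    { apply runs_to_wp; [lia|].
      apply (query_init_ok Hij Hix Hjy M3 HQ3 E6' Ej h Hh). }
    intros M4 H4. eapply runs_to_seq with
      (Q1 := fun M' => exists p, @climb_state i j p M' /\
         ~ (ig M' 11%nat < ig M' 12%nat)%Z).
    { apply runs_to_while with (I := @climb_state i j); auto.
      - cbn. auto.
      - intros p M' H L. now apply climb_ok.
      - eauto. }
    intros M5 (p & H5 & L5). apply runs_to_wp; [lia|].
    now apply (output_ok Hij Hix Hjy p). }
  destruct R as (k & M' & E & L & H). exists k, M'. split; [exact E|].
  split; [|exact H]. unfold query_cost. fold w. nia.
Qed.
End Query.

(** * Relocating the input *)

(** Source [3 n + 2] and destination [16 n + 50] are the old and new cells of the last time-stamp.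
    After three cells the destination has to go back another 13 = 16 - 3. *)
Definition copy_init : list instr :=
  [IConst 3 1; IAdd 1 0 0; IAdd 1 1 0; IConst 4 2; IAdd 1 1 4;
   IAdd 2 0 0; IAdd 2 2 2; IAdd 2 2 2; IAdd 2 2 2; IConst 4 50; IAdd 2 2 4;
   IConst 4 13; IConst 5 0; IAdd 6 0 5].

Definition copy_cell : list instr :=
  [RLoad 0 1; RStore 2 0; ISub 1 1 3; ISub 2 2 3].

Definition copy_vertex : list instr :=
  copy_cell ++ copy_cell ++ copy_cell ++ [ISub 2 2 4; ISub 6 6 3].

(* Moves vertex [i] from cells [3 + 3 i] to [64 + 16 i], the last vertex first
   so that no unread input is overwritten; this frees the cells below 64. *)
Definition copy_code : list instr :=
  copy_init ++ [IJmpLt 5 6 16; Jmp 31] ++ copy_vertex ++ [Jmp 14].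

(** The preserved cells begin at 2, the side length, because real cell 0 is scratch. Vertex [c] is
    written from [16 c + 64] on, above all input still to be read. *)
Definition copy_state (r0 : nat -> R) (n c : nat) (q : rimem) : Prop :=
  let (r, m) := q in
  (m 0%nat = Z.of_nat n /\ m 1%nat = Z.of_nat (3 * c + 2) /\
   m 2%nat = Z.of_nat (16 * c + 50) /\ m 3%nat = 1%Z /\ m 4%nat = 13%Z /\
   m 5%nat = 0%Z /\ m 6%nat = Z.of_nat c) /\
  (forall k, (2 <= k < 3 + 3 * c)%nat -> r k = r0 k) /\
  (forall i f, (c <= i < n)%nat -> (f < 3)%nat ->
     r (64 + 16 * i + f)%nat = r0 (3 + 3 * i + f)%nat).

Lemma copy_init_ok r m n : m 0%nat = Z.of_nat n ->
  copy_state r n n (runs copy_init (r, m)).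
Proof.
  intros H0. unfold runs, copy_init; cbv beta iota delta [fold_left exec1 upd Nat.eqb].
  unfold copy_state. rewrite H0. repeat split; auto; try lia.
Qed.

Lemma copy_cell_ok r m a d : m 1%nat = Z.of_nat a -> m 2%nat = Z.of_nat d ->
  m 3%nat = 1%Z -> d <> 0%nat ->
  exists r' m', runs copy_cell (r, m) = (r', m') /\
    m' 1%nat = (Z.of_nat a - 1)%Z /\ m' 2%nat = (Z.of_nat d - 1)%Z /\
    (forall k, k <> 1%nat -> k <> 2%nat -> m' k = m k) /\
    r' d = r a /\ forall k, k <> d -> k <> 0%nat -> r' k = r k.
Proof.
  intros H1 H2 H3 Hd. unfold runs, copy_cell; cbn [fold_left exec1].
  do 2 eexists. split; [reflexivity|].
  rewrite H1, H2, !Nat2Z.id.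
  repeat split; intros; upd_simpl; rewrite ?H1, ?H2, ?H3; reflexivity.
Qed.

Lemma copy_vertex_ok r0 n c q : (c < n)%nat -> copy_state r0 n (S c) q ->
  copy_state r0 n c (runs copy_vertex q).
Proof.
  destruct q as [r m]. intros Hc ((E0 & E1 & E2 & E3 & E4 & E5 & E6) & Hr & Hd).
  destruct (copy_cell_ok r m _ _ E1 E2 E3 ltac:(lia))
    as (r1 & m1 & R1 & A1 & A2 & A3 & A4 & A5).
  destruct (copy_cell_ok r1 m1 (3 * c + 4) (16 * c + 65)
    ltac:(rewrite A1; lia) ltac:(rewrite A2; lia) ltac:(rewrite A3; lia) ltac:(lia))
    as (r2 & m2 & R2 & B1 & B2 & B3 & B4 & B5).
  destruct (copy_cell_ok r2 m2 (3 * c + 3) (16 * c + 64)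
    ltac:(rewrite B1; lia) ltac:(rewrite B2; lia)
    ltac:(rewrite B3, A3; lia) ltac:(lia))
    as (r3 & m3 & R3 & C1 & C2 & C3 & C4 & C5).
  unfold copy_vertex. rewrite !runs_app, R1, R2, R3.
  unfold runs; cbn [fold_left exec1]. unfold copy_state. upd_simpl.
  rewrite C1, C2, !C3, !B3, !A3 by lia.
  split; [repeat split; auto; lia|]. split.
  - intros k Hk. rewrite C5, B5, A5 by lia. apply Hr. lia.
  - intros i f Hi Hf. destruct (Nat.eq_dec i c) as [->|N].
    + destruct f as [|[|[|f]]]; [| | |lia].
      * replace (64 + 16 * c + 0)%nat with (16 * c + 64)%nat by lia.
        rewrite C4, B5, A5 by lia. rewrite Hr by lia. f_equal. lia.
      * replace (64 + 16 * c + 1)%nat with (16 * c + 65)%nat by lia.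
        rewrite C5, B4, A5 by lia. rewrite Hr by lia. f_equal. lia.
      * replace (64 + 16 * c + 2)%nat with (16 * S c + 50)%nat by lia.
        rewrite C5, B5, A4 by lia. rewrite Hr by lia. f_equal. lia.
    + rewrite C5, B5, A5 by lia. apply Hd; lia.
Qed.

(** Position 14 is the loop test and 31 the first instruction after the copy code; a round takes 1 +
    14 + 1 instructions. *)
Lemma copy_loop_ok P r0 n : code_at P 0 copy_code -> forall c q,
  (c <= n)%nat -> copy_state r0 n c q ->
  exists q', copy_state r0 n 0 q' /\
    steps P (16 * c + 2) (at_pc 14 q) (at_pc 31 q').
Proof.
  intros HC. unfold copy_code in HC.
  apply code_at_app in HC as [_ HC]. cbn [length copy_init Nat.add] in HC.
  change ([IJmpLt 5 6 16; Jmp 31] ++ copy_vertex ++ [Jmp 14])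
    with (IJmpLt 5 6 16 :: Jmp 31 :: copy_vertex ++ [Jmp 14]) in HC.
  apply code_at_cons in HC as [C1 HC]. apply code_at_cons in HC as [C2 HC].
  apply code_at_app in HC as [C3 HC].
  apply code_at_cons in HC as [C4 _].
  induction c as [|c IH]; intros [r m] Hc HS.
  - exists (r, m). split; [exact HS|].
    destruct HS as ((_ & _ & _ & _ & _ & E5 & E6) & _).
    eapply steps_trans with (k1 := 1%nat).
    + apply steps_one, step_ijmp. exact C1.
    + rewrite E5, E6. apply steps_one. now apply step_jmp.
  - destruct (IH (runs copy_vertex (r, m)) ltac:(lia)
      (copy_vertex_ok r0 n c (r, m) ltac:(lia) HS)) as (q' & H' & S').
    exists q'. split; [exact H'|].
    replace (16 * S c + 2)%nat with (1 + (14 + (1 + (16 * c + 2))))%nat by lia.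
    destruct HS as ((_ & _ & _ & _ & _ & E5 & E6) & _).
    eapply steps_trans; [apply steps_one, step_ijmp; exact C1|].
    rewrite E5, E6. replace (0 <? Z.of_nat (S c))%Z with true by (symmetry; apply Z.ltb_lt; lia).
    eapply steps_trans; [exact (steps_straight _ _ _ _ C3 eq_refl)|].
    eapply steps_trans; [apply steps_one, step_jmp; exact C4|]. exact S'.
Qed.

Lemma copy_ok P r m n : code_at P 0 copy_code -> m 0%nat = Z.of_nat n ->
  exists q', copy_state r n 0 q' /\
    steps P (16 * n + 16) (at_pc 0 (r, m)) (at_pc 31 q').
Proof.
  intros HC H0.
  destruct (copy_loop_ok P r n HC n _ (le_n n) (copy_init_ok r m n H0))
    as (q' & H' & S').
  exists q'. split; [exact H'|].
  replace (16 * n + 16)%nat with (14 + (16 * n + 2))%nat by lia.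
  eapply steps_trans; [|exact S'].
  apply code_at_app in HC as [HC _].
  exact (steps_straight _ _ _ _ HC eq_refl).
Qed.

(** * Assembly of the two programs *)

Definition view (q : rimem) : mem :=
  Mem (fst q) (snd q) (fun f i => fst q (64 + 16 * i + f)%nat)
    (fun f i => snd q (64 + 16 * i + f)%nat).

Lemma agree_view q : agreeM (view q) q.
Proof. repeat split. Qed.

Lemma init_vertex s V i f : (i < length V)%nat -> (f < 3)%nat ->
  rmem (init_state s V) (3 + 3 * i + f)%nat = vertex_comp (vert V i) f.
Proof.
  intros Hi Hf. cbn [rmem init_state].
  destruct (Nat.eqb_spec (3 + 3 * i + f) 2) as [E|_]; [lia|].
  destruct (Nat.leb_spec 3 (3 + 3 * i + f)) as [_|E]; [|lia].
  replace (3 + 3 * i + f - 3)%nat with (f + i * 3)%nat by lia.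
  rewrite Nat.div_add, Nat.Div0.mod_add, Nat.div_small, Nat.mod_small by lia.
  cbn [Nat.add]. rewrite (nth_error_nth' V (Vertex 0 0 0) Hi). reflexivity.
Qed.

(** The factor 2 comes from [ln 2 > 1/2]. *)
Lemma log2_le_ln n : (1 <= n)%nat -> INR (Nat.log2 n) <= 2 * ln (INR n).
Proof.
  intros Hn. pose proof (Nat.log2_spec n ltac:(lia)) as [H _].
  apply le_INR in H. rewrite pow_INR in H.
  assert (H2 : INR (Nat.log2 n) * ln 2 <= ln (INR n)).
  { rewrite <- ln_pow by lra. apply ln_le; [apply pow_lt; lra | exact H]. }
  pose proof ln_lt_2. pose proof (pos_INR (Nat.log2 n)). nra.
Qed.

(* There are a preprocessing program Pre, a query program Qry (real RAM,
   unit cost per instruction) and a constant c such that for every side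
   length s > 0 and every polygonal trajectory with n >= 2 vertices:
   Pre halts within c*n steps, and afterwards every query x < y inside the
   time span is answered within c*(1 + ln n)^2 steps by a square whose
   weight w.r.t. T_xy is at least half the weight of a hotspot of T_xy. *)
Theorem theorem3 :
  exists (Pre Qry : program) (c : R),
    0 < c /\
    forall (s : R) (V : list vertex),
      0 < s ->
      (2 <= length V)%nat ->
      times_increasing V ->
      exists (kpre : nat) (M : state),
        exec Pre kpre (init_state s V) M /\
        INR kpre <= c * INR (length V) /\
        forall x y : R,
          first_time V <= x -> x < y -> y <= last_time V ->
          exists (kq : nat) (M' : state),
            exec Qry kq (query_state M x y) M' /\
            INR kq <= c * (1 + ln (INR (length V))) ^ 2 /\
            hotspot_weight s V x y <= 2 * weight s V x y (output_corner M').
Proof.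
  set (Pre := copy_code ++ code preprocess 31).
  set (Qry := code query 0).
  (* Copying takes [16 n + 16 <= 24 n] steps as [n >= 2]; the factor 3 comes from
     [3 + 2 l <= 3 (1 + l)^2] with [l = ln n]. *)
  exists Pre, Qry, (INR (24 + preprocess_cost) + 3 * INR query_cost).
  assert (Wp : cwf preprocess = true) by reflexivity.
  assert (Wq : cwf query = true) by reflexivity.
  assert (Cp : code_at Pre 0 copy_code /\ code_at Pre 31 (code preprocess 31)).
  { apply (code_at_app Pre 0 copy_code). exists [], []. split; [|reflexivity].
    cbn [app]. now rewrite app_nil_r. }
  assert (Cq : code_at Qry 0 (code query 0)).
  { exists [], []. split; [|reflexivity]. cbn [app]. now rewrite app_nil_r. }
  assert (Lp : length Pre = (31 + size preprocess)%nat).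
  { unfold Pre. now rewrite length_app, code_length. }
  assert (Lq : length Qry = size query) by (unfold Qry; apply code_length).
  (* Keeps reduction from unfolding the compiled programs. *)
  clearbody Pre Qry.
  set (cp := preprocess_cost) in *. set (cq := query_cost) in *.
  assert (Hcp : 24 <= INR (24 + cp)).
  { replace 24 with (INR 24) by (cbn; lra). apply le_INR. lia. }
  pose proof (pos_INR cq) as Hcq.
  split; [lra|]. intros s V Hs Hn HT.
  set (n := length V) in *.
  assert (Hn1 : 2 <= INR n) by (apply (le_INR 2); exact Hn).
  destruct (copy_ok Pre (rmem (init_state s V)) (imem (init_state s V)) n
    (proj1 Cp) eq_refl) as (q1 & Hq1 & S1).
  destruct q1 as [r1 m1]. destruct Hq1 as ((E0 & _) & Hr & Hd).
  destruct (preprocess_ok s V (view (r1, m1)) Hs HT Hn E0)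
    as (k2 & M2 & Ev2 & L2 & m & HP & HD).
  { cbn [view rg fst]. rewrite Hr by lia. reflexivity. }
  { intros i Hi. cbn [view ra fst].
    split; [|split]; rewrite Hd by (unfold n; lia); now rewrite init_vertex by lia. }
  destruct (compile_ok _ _ _ _ Ev2 Wp Pre 31 (r1, m1) (proj2 Cp) (agree_view _))
    as (q2 & A2 & S2).
  exists (16 * n + 16 + k2)%nat, (at_pc (31 + size preprocess) q2).
  split; [|split].
  - apply steps_exec.
    + exact (steps_trans _ _ _ _ _ _ S1 S2).
    (* The program halts by running past its last instruction. *)
    + unfold step; cbn [pc at_pc]. now rewrite (proj2 (nth_error_None _ _)) by lia.
  - fold n cp in L2.
    apply Rle_trans with (INR ((24 + cp) * n)); [apply le_INR; nia|].
    rewrite mult_INR. nra.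
  - intros x y Hx Hxy Hy.
    set (q3 := (upd (upd (fst q2) 0 x) 1 y, snd q2) : rimem).
    set (M3 := set_rg (set_rg M2 0 x) 1 y).
    assert (A3 : agreeM M3 q3).
    { destruct A2 as [Ar Ai]. split; [|exact Ai]. cbn.
      apply agree_upd; [apply agree_upd; [exact Ar|lia]|lia]. }
    destruct HP as [Em Hmn HB Hf Hl].
    assert (HQ : @query_data (ra M2) (ia M2 0%nat) m x y M3) by (repeat split; auto).
    destruct (query_ok HB (proj1 Hmn) Hf Hl HD Hx Hxy Hy (S (Nat.log2 m)) M3 Hs HQ)
      as (k3 & M4 & Ev4 & L4 & HW).
    { apply Nat.log2_spec. lia. }
    destruct (compile_ok _ _ _ _ Ev4 Wq Qry 0 q3 Cq A3) as (q4 & A4 & S4).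
    exists k3, (at_pc (0 + size query) q4). split; [|split].
    + apply steps_exec; [exact S4|].
      unfold step; cbn [pc at_pc]. now rewrite (proj2 (nth_error_None _ _)) by lia.
    + fold cq in L4.
      (* There are at most [2 n] blocks, and doubling adds one to the logarithm. *)
      assert (Hlog : (Nat.log2 m <= S (Nat.log2 n))%nat).
      { rewrite <- Nat.log2_double by lia. apply Nat.log2_le_mono. apply Hmn. }
      assert (L4' : (k3 <= cq * (3 + Nat.log2 n))%nat) by nia.
      apply le_INR in L4'. rewrite mult_INR, plus_INR in L4'.
      replace (INR 3) with 3 in L4' by (cbn; lra).
      pose proof (log2_le_ln n ltac:(lia)) as Hln.
      assert (Hln0 : 0 <= ln (INR n)) by (rewrite <- ln_1; apply ln_le; lra).
      set (l := ln (INR n)) in *.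
      apply Rle_trans with (INR cq * (3 + 2 * l)); [nra|].
      assert (3 + 2 * l <= 3 * (1 + l) ^ 2) by nra.
      apply Rle_trans with (INR cq * (3 * (1 + l) ^ 2)); [nra|].
      assert (0 <= (1 + l) ^ 2) by nra. nra.
    + unfold output_corner; cbn [rmem at_pc].
      destruct A4 as [[A4 _] _]. rewrite !A4 by lia. exact HW.
Qed.
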